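(* Let $Q:\mathbb{T}\to\mathbb{R}$ be a continuous function, let $f,g,h:\mathbb{T}\to\mathbb{R}$ be continuous functions, and fix $0<\theta<1$. Assume that $$ \mathrm{Tr}_N(h(W))\ \ge\ (1-\theta)\,\mathrm{Tr}_N(f(U))+\theta\,\mathrm{Tr}_N(g(V))+R_{\theta,N}(W;U,V)-\frac{\theta(1-\theta)}{4}\,d(U,V)^2 $$ holds for every $N\in\mathbb{N}$, every $U,V\in \mathrm{SU}(N)$ and every $W\in Z_\theta(U,V)$. Then $$ j_Q(h)\ \ge\ (1-\theta)\,j_Q(f)+\theta\, j_Q(g). $$
   Context: $\mathbb{T}$ is the unit circle in $\mathbb{C}$ and $\mathcal{M}(\mathbb{T})$ is the set of Borel probability measures on $\mathbb{T}$. For $\mu\in\mathcal{M}(\mathbb{T})$, the free entropy is $\Sigma(\mu):=\iint_{\mathbb{T}^2}\log|\zeta-\eta|\,d\mu(\zeta)\,d\mu(\eta)\in[-\infty,\infty)$. For a continuous $Q:\mathbb{T}\to\mathbb{R}$, the weighted energy integral is $E_Q(\mu):=-\Sigma(\mu)+\int_{\mathbb{T}}Q\,d\mu$ for $\mu\in\mathcal{M}(\mathbb{T})$; it admits a unique minimizer $\nu_Q\in\mathcal{M}(\mathbb{T})$. Put $B(Q):=-E_Q(\nu_Q)$. The relative free entropy with respect to $Q$ is $$\widetilde\Sigma_Q(\mu):=-\Sigma(\mu)+\int_{\mathbb{T}}Q\,d\mu+B(Q),\qquad \mu\in\mathcal{M}(\mathbb{T}),$$ and the relative free pressure with respect to $Q$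 is $$j_Q(f):=\sup\Bigl\{\int_{\mathbb{T}}f\,d\mu-\widetilde\Sigma_Q(\mu):\mu\in\mathcal{M}(\mathbb{T})\Bigr\}$$ for continuous $f:\mathbb{T}\to\mathbb{R}$. $\mathrm{SU}(N)$ is the special unitary group of order $N$, regarded as a Riemannian manifold of dimension $N^2-1$ with the bi-invariant metric induced by the Hilbert–Schmidt inner product $\langle X,Y\rangle=\mathrm{Tr}_N(XY^* )$ on its Lie algebra of trace-zero skew-Hermitian matrices (so that its Ricci curvature is the constant $N/2$); $d(U,V)$ is the corresponding geodesic distance on $\mathrm{SU}(N)$. $\mathrm{Tr}_N$ is the usual (unnormalized) trace on $N\times N$ matrices, and for a function $f$ on $\mathbb{T}$ and $U\in\mathrm{SU}(N)$, $f(U)$ is defined by functional calculus, so $\mathrm{Tr}_N(f(U))$ is the sum of $f$ over the eigenvalues of $U$ counted with multiplicity. For $U,V\in\mathrm{SU}(N)$ and $0<\theta<1$, $$Z_\theta(U,V):=\{W\in\mathrm{SU}(N): d(U,W)=\theta\, d(U,V),\ d(W,V)=(1-\theta)\,d(U,V)\}.$$ For $U,V,W\in\mathrm{SU}(N)$, $$R_{\theta,N}(W;U,V):=\mathrm{Tr}_N(Q(W))-(1-\theta)\,\mathrm{Tr}_N(Q(U))-\theta\,\mathrm{Tr}_N(Q(V)).$$ *)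

(* Defs.v *)
From HB Require Import structures.
From mathcomp Require Import all_boot all_order all_algebra.
From mathcomp Require Import complex.
From mathcomp Require Import all_classical all_reals all_analysis.

Set Implicit Arguments.
Unset Strict Implicit.
Unset Printing Implicit Defensive.

Import Order.TTheory GRing.Theory Num.Theory.
Import numFieldNormedType.Exports.

Local Open Scope classical_set_scope.
Local Open Scope ring_scope.
Local Open Scope complex_scope.
Local Open Scope sesquilinear_scope.

Section Circle.
Context {R : realType}.

Definition unit_circle : set (R[i] : numFieldType) := [set z | `|z| = 1].

(* Carries the topology induced by the inclusion in R[i]. *)
Definition circle : Type := set_type unit_circle.

HB.instance Definition _ := Topological.on circle.

Lemma unit_circle1 : (1 : R[i]) \in unit_circle.
Proof. by rewrite inE /unit_circle /= normr1. Qed.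

Definition circle1 : circle := exist _ (1 : R[i]) unit_circle1.

HB.instance Definition _ := isPointed.Build circle circle1.

End Circle.

Arguments circle R : clear implicits.

Definition borel_circle (R : realType) := g_sigma_algebraType (@open (circle R)).

Definition circle_prob (R : realType) := probability (borel_circle R) R.

Section FreePressure.
Context {R : realType}.
Local Open Scope ereal_scope.

(* [lne 0] is [-oo], unlike [ln 0] which is [0]: the diagonal must count
   as [-oo] in the logarithmic energy. *)
Definition free_entropy (mu : circle_prob R) : \bar R :=
  \int[(mu \x mu)]_p lne (Normc.normc (set_val p.1 - set_val p.2)%R)%:E.

Definition weighted_energy (Q : circle R -> R) (mu : circle_prob R) : \bar R :=
  - free_entropy mu + \int[mu]_z (Q z)%:E.

(* For continuous Q the energy has exactly one minimizer, so the default
   value of [xget] is never used. *)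
Definition equilibrium_measure (Q : circle R -> R) : circle_prob R :=
  xget (\d_ (circle1 : borel_circle R) : circle_prob R)
    [set nu | forall mu : circle_prob R,
                weighted_energy Q nu <= weighted_energy Q mu].

Definition energy_constant (Q : circle R -> R) : \bar R :=
  - weighted_energy Q (equilibrium_measure Q).

Definition relative_free_entropy (Q : circle R -> R) (mu : circle_prob R)
    : \bar R :=
  - free_entropy mu + \int[mu]_z (Q z)%:E + energy_constant Q.

Definition relative_free_pressure (Q f : circle R -> R) : \bar R :=
  ereal_sup [set \int[mu]_z (f z)%:E - relative_free_entropy Q mu
            | mu in [set: circle_prob R]].

End FreePressure.

Section SpecialUnitary.
Context {R : realType}.
Implicit Type N : nat.

Definition SU N : set 'M[R[i]]_N :=
  [set U | U \is unitarymx /\ \det U = 1].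
Arguments SU : clear implicits.

(* The eigenvalues of a unitary matrix lie on the unit circle, so the value
   of the extension off the circle is irrelevant. *)
Definition circle_ext (f : circle R -> R) (z : R[i]) : R[i] :=
  (f (insubd circle1 z))%:C.

Definition fun_calculus N (f : circle R -> R) (U : 'M[R[i]]_N) : 'M[R[i]]_N :=
  invmx (spectralmx U) *m diag_mx (map_mx (circle_ext f) (spectral_diag U))
    *m spectralmx U.

(* Since f is real-valued this trace is real; [complex.Re] only changes type. *)
Definition trace_fun N (f : circle R -> R) (U : 'M[R[i]]_N) : R :=
  complex.Re (\tr (fun_calculus f U)).

Definition C1 (u : R -> R) : Prop :=
  (forall t, derivable u t 1) /\ continuous (derive1 u).

Definition C1_curve N (g : R -> 'M[R[i]]_N) : Prop :=
  forall i j, C1 (fun t => complex.Re (g t i j)) /\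
              C1 (fun t => complex.Im (g t i j)).

Definition velocity N (g : R -> 'M[R[i]]_N) (t : R) : 'M[R[i]]_N :=
  \matrix_(i, j) ((derive1 (fun s => complex.Re (g s i j)) t) +i*
                  (derive1 (fun s => complex.Im (g s i j)) t)).

Definition hs_norm N (X : 'M[R[i]]_N) : R :=
  Num.sqrt (complex.Re (\tr (X *m X ^t*))).

(* The tangent vector at g(t) is brought to the Lie algebra by left
   translation by the inverse of g(t), which is its adjoint. *)
Definition curve_length N (g : R -> 'M[R[i]]_N) : R :=
  \int[lebesgue_measure]_(t in `[0, 1]%classic)
    hs_norm ((g t) ^t* *m velocity g t).

(* Only g on [0, 1] matters: every C^1 curve on [0, 1] extends to a C^1
   matrix-valued function on R.  Piecewise C^1 curves would give the same
   set of lengths, since they become C^1 after a reparametrization that has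
   zero velocity at the break points. *)
Definition SU_curve N (U V : 'M[R[i]]_N) : set (R -> 'M[R[i]]_N) :=
  [set g | [/\ C1_curve g, {in `[0, 1], forall t, SU N (g t)},
               g 0 = U & g 1 = V]].

Definition geodesic_dist N (U V : 'M[R[i]]_N) : R :=
  inf [set curve_length g | g in SU_curve U V].

Definition Zset N (theta : R) (U V : 'M[R[i]]_N) : set 'M[R[i]]_N :=
  [set W | [/\ SU N W,
     geodesic_dist U W = theta * geodesic_dist U V &
     geodesic_dist W V = (1 - theta) * geodesic_dist U V]].

Definition Rdefect N (Q : circle R -> R) (theta : R) (W U V : 'M[R[i]]_N) : R :=
  trace_fun Q W - (1 - theta) * trace_fun Q U - theta * trace_fun Q V.

End SpecialUnitary.

Arguments SU {R} N _.

(* Main.v *)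
Require Import Defs.
From HB Require Import structures.
From mathcomp Require Import all_boot all_order all_algebra.
From mathcomp Require Import complex.
From mathcomp Require Import all_classical all_reals all_analysis.
From mathcomp Require Import measurable_realfun.
From mathcomp Require Import perm ring lra.
Import Order.TTheory GRing.Theory Num.Theory.
Import numFieldNormedType.Exports.
Local Open Scope classical_set_scope.
Local Open Scope ring_scope.
Local Open Scope complex_scope.

(** The inequality is reduced to a displacement convexity statement for the
logarithmic energy on the circle, combined with the hypothesis for diagonal
matrices of large size.

Let mu and nu be probability measures on the circle. They are the laws of
exp(i X) and exp(i Y) on [0, 1], where X and Y are nondecreasing, have
oscillation at most 2 pi, and have mean 0 ([circle_lift]). Let la be the law of
exp(i Z) with Z = (1 - theta) X + theta Y. It suffices to use la as a competitor
in the supremum that defines j_Q(h), and to compare energies and linear terms.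

Energy. Two points at angular distance u have energy - log |2 sin (u / 2)|, and
- log sin (u / 2) - u^2 / 8 is convex on (0, 2 pi). For t <= s the increments of
X and Y from t to s lie in [0, 2 pi], so the energy is convex along Z, with a
quadratic gain. As Y - X has mean 0, the gain is theta (1 - theta) / 4 times the
mean of (Y - X)^2 ([lift_energy_convex]).

Linear terms. Sample X and Y at n points, with a small shift that makes the sums
of the angles vanish, and apply the hypothesis to the diagonal matrices U, V and
W whose angles are the x_j, the y_j and the (1 - theta) x_j + theta y_j. If W
lies in Z_theta(U, V) and d(U, V)^2 is the sum of the (y_j - x_j)^2, then
dividing by n and letting n tend to infinity ([riemann_nonneg]) gives the
inequality between the integrals of h, f, g and Q, with a loss of
theta (1 - theta) / 4 times the mean of (Y - X)^2. The loss equals the gain.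

Distance. It remains to see that the straight segment between the angles is a
minimal geodesic of SU(N), although an angle may move by more than pi. Put
d_j = y_j - x_j; the d_j have sum 0 and differ by at most 2 pi, so that
|d_j - c| <= pi for some c. Twist a curve g from U to V by exp(- i c s), with s
the normalized arc length. The columns of the twisted curve move on the unit
sphere and turn by the angles d_j - c, so its squared length is at least the sum
of the (d_j - c)^2, which is N c^2 more than the sum of the d_j^2. On the other
hand the velocity of g is orthogonal to i g because det g = 1, so the squared
length of the twisted curve is L^2 + N c^2, where L is the length of g. Hence
L^2 is at least the sum of the d_j^2 ([SU_curve_length_ge],
[geodesic_dist_diag_cis]).

The constant B(Q) cancels when it is finite; when it is infinite all three free
pressures are infinite, of the same sign. *)

Set Implicit Arguments.
Unset Strict Implicit.
Unset Printing Implicit Defensive.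

(** * Complex-valued functions of a real variable *)
Section ComplexDerivative.
Context {R : realType}.
Implicit Types (u v : R -> R[i]) (z w : R[i]).

Lemma conjCE z : Num.conj z = (complex.Re z) -i* (complex.Im z).
Proof. by case: z. Qed.

Lemma ReD z w : complex.Re (z + w) = complex.Re z + complex.Re w.
Proof. by case: z; case: w. Qed.
Lemma ImD z w : complex.Im (z + w) = complex.Im z + complex.Im w.
Proof. by case: z; case: w. Qed.
Lemma ReN z : complex.Re (- z) = - complex.Re z.
Proof. by case: z. Qed.
Lemma ImN z : complex.Im (- z) = - complex.Im z.
Proof. by case: z. Qed.
Lemma ReM z w : complex.Re (z * w) =
  complex.Re z * complex.Re w - complex.Im z * complex.Im w.
Proof. by case: z; case: w. Qed.
Lemma ImM z w : complex.Im (z * w) =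
  complex.Re z * complex.Im w + complex.Im z * complex.Re w.
Proof. by case: z; case: w. Qed.
Lemma Re_sum (I : Type) (r : seq I) (P : pred I) (F : I -> R[i]) :
  complex.Re (\sum_(i <- r | P i) F i) = \sum_(i <- r | P i) complex.Re (F i).
Proof. exact: (big_morph _ ReD). Qed.
Lemma Im_sum (I : Type) (r : seq I) (P : pred I) (F : I -> R[i]) :
  complex.Im (\sum_(i <- r | P i) F i) = \sum_(i <- r | P i) complex.Im (F i).
Proof. exact: (big_morph _ ImD). Qed.
Lemma complex_ext z w : complex.Re z = complex.Re w ->
  complex.Im z = complex.Im w -> z = w.
Proof. by case: z; case: w => /= ? ? ? ? -> ->. Qed.

(** Derivatives are taken separately on the real and imaginary parts because
the velocity of a matrix curve is defined entrywise that way. *)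
Definition is_cderive u (t : R) (du : R[i]) :=
  is_derive t 1 (fun s => complex.Re (u s)) (complex.Re du) /\
  is_derive t 1 (fun s => complex.Im (u s)) (complex.Im du).

Lemma is_cderive_cst z t : is_cderive (fun=> z) t 0.
Proof. by split; exact: is_derive_cst. Qed.

Lemma is_cderiveD u v t du dv : is_cderive u t du -> is_cderive v t dv ->
  is_cderive (fun s => u s + v s) t (du + dv).
Proof.
move=> [ur ui] [vr vi]; split.
  under eq_fun do rewrite ReD.
  by rewrite ReD; exact: is_deriveD.
under eq_fun do rewrite ImD.
by rewrite ImD; exact: is_deriveD.
Qed.

Lemma is_cderiveM u v t du dv : is_cderive u t du -> is_cderive v t dv ->
  is_cderive (fun s => u s * v s) t (du * v t + u t * dv).
Proof.
move=> [ur ui] [vr vi]; split.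
  under eq_fun do rewrite ReM.
  apply: is_derive_eq.
  by rewrite /= ReD !ReM /GRing.scale /=; ring.
under eq_fun do rewrite ImM.
apply: is_derive_eq.
by rewrite /= ImD !ImM /GRing.scale /=; ring.
Qed.

Lemma is_cderive_sum (I : Type) (r : seq I) (F : I -> R -> R[i]) dF t :
  (forall i, is_cderive (F i) t (dF i)) ->
  is_cderive (fun s => \sum_(i <- r) F i s) t (\sum_(i <- r) dF i).
Proof.
move=> FdF; elim: r => [|i r IH].
  by rewrite big_nil; under eq_fun do rewrite big_nil; exact: is_cderive_cst.
rewrite big_cons; under eq_fun do rewrite big_cons.
exact: is_cderiveD.
Qed.

Lemma is_cderive_prod (I : eqType) (r : seq I) (F : I -> R -> R[i]) dF t :
  uniq r -> (forall i, is_cderive (F i) t (dF i)) ->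
  is_cderive (fun s => \prod_(i <- r) F i s) t
    (\sum_(k <- r) \prod_(i <- r) if i == k then dF i else F i t).
Proof.
move=> + FdF; elim: r => [|a r IH] /=.
  have -> : (fun s => \prod_(i <- [::]) F i s) = fun=> 1 by apply/funext => s; rewrite big_nil.
  by rewrite big_nil => _; exact: is_cderive_cst.
move=> /andP[ar /IH{}IH]; under eq_fun do rewrite big_cons.
have -> : \sum_(k <- a :: r) \prod_(i <- a :: r) (if i == k then dF i else F i t)
  = dF a * (\prod_(i <- r) F i t) +
    F a t * \sum_(k <- r) \prod_(i <- r) (if i == k then dF i else F i t).
  rewrite big_cons big_cons eqxx; congr (_ * _ + _).
    apply: eq_big_seq => i ir; case: eqP => // ia.
    by rewrite -ia ir in ar.
  rewrite big_distrr; apply: eq_big_seq => k kr /=.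
  rewrite big_cons; case: eqP => // ak.
  by rewrite ak kr in ar.
exact: is_cderiveM.
Qed.

Lemma is_cderive_unique u t du dv : is_cderive u t du -> is_cderive u t dv -> du = dv.
Proof.
move=> [[_ a] [_ b]] [[_ c] [_ d]]; apply: complex_ext.
  by rewrite -a -c.
by rewrite -b -d.
Qed.

Lemma is_cderive_near_cst u z t du : (\forall s \near t, u s = z) ->
  is_cderive u t du -> du = 0.
Proof.
move=> uz ud; apply: (is_cderive_unique ud); split.
  have := is_derive_cst (complex.Re z) t 1.
  apply: near_eq_is_derive; rewrite /cst.
  by apply: filterS uz => s ->.
have := is_derive_cst (complex.Im z) t 1.
apply: near_eq_is_derive; rewrite /cst.
by apply: filterS uz => s ->.
Qed.

(** Jacobi's formula. Differentiating the Leibniz expansion factor by factor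
gives the sum over k of the determinants with row k replaced by its
derivative; each of them is then expanded along that row. *)
Lemma is_cderive_det N (g : R -> 'M[R[i]]_N) dg t :
  (forall i j, is_cderive (fun s => g s i j) t (dg i j)) ->
  is_cderive (fun s => \det (g s)) t (\sum_i \sum_j dg i j * cofactor (g t) i j).
Proof.
move=> gdg.
have -> : \sum_i \sum_j dg i j * cofactor (g t) i j =
  \sum_(s : 'S_N) ((-1) ^+ s * \sum_(k <- index_enum 'I_N)
     \prod_(i <- index_enum 'I_N) if i == k then dg i (s i) else g t i (s i)).
  transitivity (\sum_k \det (\matrix_(i, j) if i == k then dg i j else g t i j)).
    apply: eq_bigr => k _; rewrite (expand_det_row _ k).
    apply: eq_bigr => j _; rewrite mxE eqxx; congr (_ * _).
    rewrite /cofactor; congr (_ * \det _).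
    by apply/matrixP => a b; rewrite !mxE eq_sym (negPf (neq_lift _ _)).
  under eq_bigr do rewrite /determinant.
  rewrite exchange_big /=; apply: eq_bigr => s _.
  rewrite big_distrr; apply: eq_bigr => k _ /=; congr (_ * _).
  by apply: eq_bigr => i _; rewrite mxE.
rewrite /determinant; apply: is_cderive_sum => s.
rewrite -[X in is_cderive _ _ X]add0r -[X in is_cderive _ _ (X + _)](mul0r (\prod_i (g t i (s i)))).
apply: is_cderiveM; first exact: is_cderive_cst.
apply: (@is_cderive_prod _ _ (fun i s' => g s' i (s i)) (fun i => dg i (s i))) => //.
exact: index_enum_uniq.
Qed.

End ComplexDerivative.

(** * Angles swept by curves on a sphere *)

Section SphereArc.
Context {R : realType}.

(** Lagrange's identity: twice the difference of the two sides is the double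
sum of the squares (a i * b j - a j * b i) ^+ 2. *)
Lemma cauchy_schwarz_sum (I : finType) (a b : I -> R) :
  (\sum_i a i * b i) ^+ 2 <= (\sum_i a i ^+ 2) * (\sum_i b i ^+ 2).
Proof.
suff : 0 <= ((\sum_i a i ^+ 2) * (\sum_i b i ^+ 2) - (\sum_i a i * b i) ^+ 2) *+ 2.
  by rewrite pmulrn_lge0// subr_ge0.
have -> : ((\sum_i a i ^+ 2) * (\sum_i b i ^+ 2) - (\sum_i a i * b i) ^+ 2) *+ 2
   = \sum_i \sum_j (a i * b j - a j * b i) ^+ 2.
  set X := \sum_i a i ^+ 2; set Y := \sum_i b i ^+ 2; set Z := \sum_i a i * b i.
  transitivity (X * Y + Y * X - Z * Z - Z * Z); first by ring.
  rewrite !big_distrlr /= -!sumrN -!big_split /=; apply: eq_bigr => i _.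
  by rewrite -!sumrN -!big_split /=; apply: eq_bigr => j _; ring.
by apply: sumr_ge0 => i _; apply: sumr_ge0 => j _; exact: sqr_ge0.
Qed.

Lemma within_continuous_acos : {within `[-1, 1], continuous (@acos R)}.
Proof.
have := @segment_can_ge_continuous R 0 pi cos acos (pi_ge0 R).
rewrite cos0 cospi; apply.
  exact/continuous_subspaceT/continuous_cos.
by move=> x; exact: cosK.
Qed.

Lemma acos_cos_norm (x : R) : `|x| <= pi -> acos (cos x) = `|x|.
Proof.
move=> xpi; have -> : cos x = cos `|x|.
  by case: (ler0P x) => // _; rewrite cosN.
by rewrite cosK// in_itv/= normr_ge0.
Qed.

Variables (N : nat) (r dr : 'I_N -> R -> R) (w : 'I_N -> R -> R).
Variables (S dS : R -> R) (alpha : 'I_N -> R) (K : R).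

Hypothesis r_derive : forall j (t : R), t \in `]0, 1[ -> is_derive t 1 (r j) (dr j t).
Hypothesis S_derive : forall t : R, t \in `]0, 1[ -> is_derive t 1 S (dS t).
Hypothesis r_cont : forall j (t : R), t \in `[0, 1] -> {for t, continuous (r j)}.
Hypothesis r_le1 : forall j (t : R), t \in `[0, 1] -> `|r j t| <= 1.
Hypothesis w_ge0 : forall j t, 0 <= w j t.
Hypothesis dr_le : forall j (t : R), t \in `]0, 1[ ->
  dr j t ^+ 2 <= w j t ^+ 2 * (1 - r j t ^+ 2).
Hypothesis S_cont : forall t : R, t \in `[0, 1] -> {for t, continuous S}.
Hypothesis dS_ge0 : forall t : R, t \in `]0, 1[ -> 0 <= dS t.
Hypothesis K_ge0 : 0 <= K.
Hypothesis w_le : forall t : R, t \in `]0, 1[ -> \sum_j w j t ^+ 2 <= (K * dS t) ^+ 2.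
Hypotheses (S0 : S 0 = 0) (S1 : S 1 = 1).
Hypothesis r0 : forall j, r j 0 = 1.
Hypothesis r1 : forall j, r j 1 = cos (alpha j).
Hypothesis alpha_le : forall j, `|alpha j| <= pi.

Let A := Num.sqrt (\sum_j alpha j ^+ 2).

(** In the application r j is the cosine of the angle between the j-th column
of a moving unitary matrix and a moving unit vector, w j bounds the speed of
that angle, and S is a clock running from 0 to 1. Cauchy-Schwarz against the
weights alpha j shows that the weighted sum of the angles grows at most as fast
as A * K * S. The derivative of acos is singular at 1 and -1, so the cosines
are first multiplied by k < 1: this only slows the angles down, since
k ^+ 2 * (1 - r ^+ 2) <= 1 - (k * r) ^+ 2 when |r| <= 1. *)
Lemma sphere_arc_shrunk (k : R) : 0 < k < 1 ->
  \sum_j `|alpha j| * acos (k * cos (alpha j)) <=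
  \sum_j `|alpha j| * acos (k * 1) + A * K.
Proof.
move=> /andP[k0 k1].
pose F j t := acos (k * r j t).
have kr j (t : R) : t \in `[0, 1] -> -1 < k * r j t < 1.
  move=> /(@r_le1 j); rewrite ler_norml => /andP[ra rb]; nra.
pose dF j t := - (Num.sqrt (1 - (k * r j t) ^+ 2))^-1 * (k * dr j t).
have oc (t : R) : t \in `]0, 1[ -> t \in `[0, 1].
  by rewrite !in_itv/= => /andP[/ltW -> /ltW ->].
have F_derive j (t : R) : t \in `]0, 1[ -> is_derive t 1 (F j) (dF j t).
  move=> t01.
  have da := is_derive1_acos (kr j t (oc _ t01)).
  have drk : is_derive t 1 (fun s => k * r j s) (k * dr j t).
    have := r_derive j t01 => ?.
    apply: is_derive_eq.
    by rewrite /GRing.scale /= ?mulr0 ?addr0.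
  have := @is_derive1_comp R acos (fun s => k * r j s) t _ _ da drk.
  by rewrite /dF mulrC.
pose G t := \sum_j `|alpha j| * F j t - A * K * S t.
pose dG t := \sum_j `|alpha j| * dF j t - A * K * dS t.
have G_derive (t : R) : t \in `]0, 1[ -> is_derive t 1 G (dG t).
  move=> t01.
  have d1 : is_derive t 1 (\sum_j (fun s => `|alpha j| * F j s))
      (\sum_j `|alpha j| * dF j t).
    apply: is_derive_sum => j; have := F_derive j _ t01 => ?.
    by apply: is_derive_eq; rewrite /GRing.scale /= ?mulr0 ?addr0.
  have d2 : is_derive t 1 (fun s => A * K * S s) (A * K * dS t).
    have := S_derive t01 => ?.
    by apply: is_derive_eq; rewrite /GRing.scale /= ?mulr0 ?addr0.
  have -> : G = (\sum_j (fun s => `|alpha j| * F j s)) - (fun s => A * K * S s).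
    by apply/funext => s; rewrite /G fctE/= fct_sumE.
  exact: is_deriveB.
have dG_le0 (t : R) : t \in `]0, 1[ -> dG t <= 0.
  move=> t01; rewrite subr_le0.
  have := kr _ _ (oc _ t01) => krt.
  have dF_le j : dF j t <= w j t.
    have [k1a k1b] := andP (krt j).
    have pos : 0 < 1 - (k * r j t) ^+ 2 by nra.
    rewrite /dF mulNr -mulrN -ler_pdivlMl ?invr_gt0 ?sqrtr_gt0// invrK.
    apply: le_trans (ler_norm _) _; rewrite normrN -ler_sqr; last 2 first.
      by rewrite nnegrE.
      by rewrite nnegrE mulr_ge0// ?sqrtr_ge0// w_ge0.
    rewrite real_normK ?num_real// exprMn exprMn sqr_sqrtr ?(ltW pos)//.
    have := dr_le j t01; have := w_ge0 j t; have : 0 <= dr j t ^+ 2 := sqr_ge0 _.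
    have : 0 <= w j t ^+ 2 := sqr_ge0 _.
    have := r_le1 j (oc _ t01); rewrite -(@ler_sqr _ `|_|) ?nnegrE//.
    rewrite expr1n real_normK ?num_real//.
    have : 0 <= r j t ^+ 2 := sqr_ge0 _.
    rewrite exprMn; move: (dr j t ^+ 2) (w j t ^+ 2) (r j t ^+ 2) => D W X.
    move=> X0 X1 W0 D0 _ DW.
    apply: (le_trans (y := k ^+ 2 * (W * (1 - X)))).
      by rewrite ler_wpM2l// sqr_ge0.
    have kk : k ^+ 2 <= 1 by nra.
    have kk0 : 0 <= k ^+ 2 by nra.
    rewrite mulrCA [X in _ <= X]mulrC ler_wpM2l//; nra.
  apply: (le_trans (y := \sum_j `|alpha j| * w j t)).
    by apply: ler_sum => j _; rewrite ler_wpM2l.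
  apply: le_trans (ler_norm _) _; rewrite -ler_sqr; last 2 first.
    by rewrite nnegrE.
    by rewrite nnegrE mulr_ge0 ?dS_ge0// mulr_ge0// sqrtr_ge0.
  rewrite real_normK ?num_real//.
  apply: le_trans (cauchy_schwarz_sum _ _) _.
  rewrite -mulrA exprMn sqr_sqrtr ?sumr_ge0// => [|j _]; last exact: sqr_ge0.
  under eq_bigr do rewrite real_normK ?num_real//.
  by rewrite ler_wpM2l ?w_le// sumr_ge0// => j _; exact: sqr_ge0.
have G_cont : {within `[0, 1], continuous G}.
  apply: continuous_in_subspaceT => t /[!inE]/= t01.
  apply: cvgB; last by apply: cvgM; [exact: cvg_cst|exact: S_cont].
  apply: cvg_big => [|j _]; first exact: add_continuous.
  apply: cvgM; first exact: cvg_cst.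
  apply: (@continuous_comp _ _ _ (fun s => k * r j s) acos).
    by apply: cvgM; [exact: cvg_cst|exact: r_cont].
  exact/continuous_acos/kr.
have G10 : G 1 <= G 0.
  have [c c01 E] := @MVT _ G dG 0 1 ltr01 G_derive G_cont.
  by rewrite -subr_le0 E subr0 mulr1 dG_le0.
have E0 : G 0 = \sum_j `|alpha j| * acos (k * 1).
  rewrite /G S0 mulr0 subr0; apply: eq_bigr => j _.
  by rewrite /F r0.
have E1 : G 1 = \sum_j `|alpha j| * acos (k * cos (alpha j)) - A * K.
  rewrite /G S1 [A * K * 1]mulr1; congr (_ - _).
  by apply: eq_bigr => j _; rewrite /F r1.
by move: G10; rewrite E0 E1 lerBlDr.
Qed.

(** The limit k --> 1 of [sphere_arc_shrunk]: angles that end at alpha j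
cannot be reached by columns whose total speed is smaller than the norm of
alpha. *)
Lemma sphere_arc_le : \sum_j alpha j ^+ 2 <= K ^+ 2.
Proof.
have lim1 (u : R) : -1 <= u <= 1 -> acos (k * u) @[k --> 1^'-] --> acos u.
  move=> u1; have u01 : u \in `[-1, 1] by rewrite in_itv.
  have /subspace_continuousP/(_ u u01) acos_u := within_continuous_acos.
  apply: (cvg_comp (fun k => k * u) acos) acos_u => P uP.
  have ku : k * u @[k --> 1^'-] --> u.
    rewrite -[X in _ --> X]mul1r; apply: cvgM; last exact: cvg_cst.
    exact/cvg_at_left_filter/cvg_id.
  have {}ku := ku _ uP; rewrite !nbhs_simpl/= in ku *.
  near=> k; apply: (near ku k) => //=; rewrite in_itv/=.
  have k0 : 0 < k by near: k; exact: nbhs_left_gt.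
  have k1 : k < 1 by near: k; exact: nbhs_left_lt.
  by move/andP: u1 => [ua ub]; apply/andP; split; nra.
have A0 : 0 <= A by exact: sqrtr_ge0.
have sA : \sum_j alpha j ^+ 2 = A ^+ 2.
  by rewrite sqr_sqrtr// sumr_ge0// => j _; exact: sqr_ge0.
rewrite sA ler_sqr ?nnegrE//.
have [->//|An0] := eqVneq A 0.
rewrite -(ler_pM2l (_ : 0 < A)) ?lt_neqAle 1?eq_sym ?An0//.
have -> : A * A = \sum_j `|alpha j| * acos (cos (alpha j)).
  rewrite -expr2 -sA; apply: eq_bigr => j _.
  by rewrite acos_cos_norm// -expr2 real_normK ?num_real.
have -> : A * K = \sum_j `|alpha j| * acos 1 + A * K.
  by rewrite acos1 big1 ?add0r// => j _; rewrite mulr0.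
have cvgs (u : 'I_N -> R) : (forall j, -1 <= u j <= 1) ->
    \sum_j `|alpha j| * acos (k * u j) @[k --> 1^'-] --> \sum_j `|alpha j| * acos (u j).
  move=> u1; apply: cvg_big => [|j _]; first exact: add_continuous.
  by apply: cvgM; [exact: cvg_cst|exact: lim1].
apply: (@ler_cvg_to _ ((1:R)^'-) _ _ (fun k => \sum_j `|alpha j| * acos (k * cos (alpha j)))
  (fun k => \sum_j `|alpha j| * acos (k * 1) + A * K)).
- by apply: cvgs => j; rewrite cos_geN1 cos_le1.
- apply: cvgD; last exact: cvg_cst.
  by apply: (cvgs (fun=> 1)) => j; rewrite lexx andbT (le_trans (lerN10 _) ler01).
near=> k; apply: sphere_arc_shrunk; apply/andP; split.
  by near: k; exact: nbhs_left_gt.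
by near: k; exact: nbhs_left_lt.
Unshelve. all: by end_near.
Qed.
End SphereArc.

(** * Diagonal unitary matrices *)
Section Cis.
Context {R : realType}.
Implicit Types (x y : R) (z w : R[i]).

Definition cis x : R[i] := cos x +i* sin x.

Definition normsq z : R := complex.Re z ^+ 2 + complex.Im z ^+ 2.

Lemma normsq_ge0 z : 0 <= normsq z.
Proof. by rewrite addr_ge0// sqr_ge0. Qed.

Lemma normsq_conj z : z * Num.conj z = (normsq z)%:C.
Proof. by case: z => a b; apply: complex_ext => /=; rewrite /normsq /=; ring. Qed.

Lemma normsq_cis x : normsq (cis x) = 1.
Proof. exact: cos2Dsin2. Qed.

Lemma cis0 : cis 0 = 1.
Proof. by rewrite /cis cos0 sin0. Qed.

Lemma cisD x y : cis (x + y) = cis x * cis y.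
Proof. by apply: complex_ext => /=; rewrite ?cosD ?sinD//; ring. Qed.

Lemma conj_cis x : Num.conj (cis x) = cis (- x).
Proof. by rewrite /cis cosN sinN. Qed.

Lemma cis_sum (I : Type) (r : seq I) (F : I -> R) :
  cis (\sum_(i <- r) F i) = \prod_(i <- r) cis (F i).
Proof. exact: (big_morph _ cisD cis0). Qed.

Lemma is_cderive_cis (phi : R -> R) (t dphi : R) : is_derive t 1 phi dphi ->
  is_cderive (fun s => cis (phi s)) t (dphi%:C * 'i * cis (phi t)).
Proof.
move=> d; split; rewrite /cis /=.
  have := @is_derive1_comp R cos phi t _ _ (is_derive_cos _) d.
  by move=> h; apply: (is_derive_eq h); ring.
have := @is_derive1_comp R sin phi t _ _ (is_derive_sin _) d.
by move=> h; apply: (is_derive_eq h); ring.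
Qed.

Lemma normsqB_scale z w (r : R) : normsq (z - r%:C * w) =
  normsq z - r * complex.Re (Num.conj z * w) *+ 2 + r ^+ 2 * normsq w.
Proof. by case: z w => a b [c d]; rewrite /normsq /=; ring. Qed.

Lemma cauchy_schwarz_complex (I : finType) (a b : I -> R[i]) :
  complex.Re (\sum_i Num.conj (a i) * b i) ^+ 2 <=
  (\sum_i normsq (a i)) * (\sum_i normsq (b i)).
Proof.
pose p (c : I -> R[i]) (k : I + I) :=
  match k with inl i => complex.Re (c i) | inr i => complex.Im (c i) end.
have := cauchy_schwarz_sum (p a) (p b).
rewrite !big_sumType /= -!big_split /=.
have -> // : \sum_i (complex.Re (a i) * complex.Re (b i) +
    complex.Im (a i) * complex.Im (b i)) = complex.Re (\sum_i Num.conj (a i) * b i).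
rewrite Re_sum; apply: eq_bigr => i _.
by rewrite conjCE ReM/= mulNr opprK.
Qed.

Lemma sum_delta (V : nmodType) (I : finType) (j : I) (F : I -> V) :
  \sum_i F i *+ (i == j) = F j.
Proof.
rewrite (bigD1 j)//= eqxx mulr1n big1 ?addr0// => i /negPf ->.
by rewrite mulr0n.
Qed.

End Cis.

Section DiagonalDistance.
Context {R : realType} (N : nat).
Local Open Scope sesquilinear_scope.
Implicit Types (x y : 'I_N -> R).

Definition diag_cis x : 'M[R[i]]_N := diag_mx (\row_j cis (x j)).

Lemma diag_cisE x i j : diag_cis x i j = cis (x i) *+ (i == j).
Proof. by rewrite !mxE. Qed.

Lemma SU_diag_cis x : \sum_j x j = 0 -> SU N (diag_cis x).
Proof.
move=> x0; split.
  apply/unitarymxP/matrixP => i j; rewrite !mxE (bigD1 i)//= big1 => [|k ki].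
    rewrite addr0 !mxE eqxx mulr1n eq_sym; have [->|ij] := eqVneq i j.
      by rewrite mulr1n normsq_conj normsq_cis.
    by rewrite mulr0n conjC0 mulr0.
  by rewrite !mxE eq_sym (negPf ki) mulr0n mul0r.
rewrite det_diag; under eq_bigr do rewrite mxE.
by rewrite -cis_sum x0 cis0.
Qed.

(** Left translation by a unitary matrix is an isometry, so the length of a
curve is its length in the Euclidean space of matrices. *)
Lemma hs_norm_unitary (U V : 'M[R[i]]_N) : U \is unitarymx ->
  hs_norm (U^t* *m V) = Num.sqrt (\sum_i \sum_j normsq (V i j)).
Proof.
move=> /unitarymxP UU; congr Num.sqrt.
rewrite trmx_mul map_mxM/= map_trmx trmxK -map_mx_comp.
rewrite (map_mx_id (@conjCK _)) mxtrace_mulC mulmxA -[_ *m U *m _]mulmxA UU mulmx1.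
rewrite mxtrace_mulC /mxtrace Re_sum; apply: eq_bigr => i _.
rewrite mxE Re_sum; apply: eq_bigr => j _.
by rewrite !mxE normsq_conj.
Qed.

Lemma curve_length_ge0 (g : R -> 'M[R[i]]_N) : 0 <= curve_length g.
Proof. by apply: Rintegral_ge0 => t _; exact: sqrtr_ge0. Qed.

End DiagonalDistance.

(** * Curves in SU(N) *)
Section CurveLowerBound.
Context {R : realType} (N : nat).
Local Open Scope sesquilinear_scope.

Lemma is_cderive_velocity (g : R -> 'M[R[i]]_N) : C1_curve g ->
  forall t i j, is_cderive (fun s => g s i j) t (velocity g t i j).
Proof.
move=> gC t i j; have [[dr _] [di _]] := gC i j.
split; rewrite /velocity mxE /= derive1E; exact: derivableP.
Qed.

Lemma is_cderive_conj (u : R -> R[i]) t du : is_cderive u t du ->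
  is_cderive (fun s => Num.conj (u s)) t (Num.conj du).
Proof.
move=> [ur ui]; rewrite conjCE; split.
  by under eq_fun do rewrite conjCE.
under eq_fun do rewrite conjCE.
exact: is_deriveN.
Qed.

Lemma unitary_col_normsq (U : 'M[R[i]]_N) j : U \is unitarymx ->
  \sum_i Num.conj (U i j) * U i j = 1.
Proof.
move=> /unitarymxP /mulmx1C /matrixP /(_ j j); rewrite !mxE eqxx mulr1n => <-.
by apply: eq_bigr => i _; rewrite !mxE.
Qed.

(** The adjugate of a matrix of determinant 1 is its inverse, which here is
the adjoint. *)
Lemma unitary_cofactor (U : 'M[R[i]]_N) i j : SU N U ->
  cofactor U i j = Num.conj (U i j).
Proof.
move=> [UU dU].
have := mul_mx_adj U; rewrite dU => E.
have : U^t* *m (U *m \adj U) = U^t* by rewrite E mulmx1.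
have /unitarymxP/mulmx1C UU' := UU.
rewrite mulmxA UU' mul1mx => /matrixP/(_ j i).
by rewrite !mxE.
Qed.

Variables (g : R -> 'M[R[i]]_N).
Hypothesis gC : C1_curve g.
Hypothesis gSU : {in `[0, 1], forall t, SU N (g t)}.
Local Notation v := (velocity g).

Let near_SU (t : R) : t \in `]0, 1[ -> \forall s \near t, SU N (g s).
Proof.
move=> /near_in_itvoo; apply: filterS => s s01; apply: gSU.
by move: s01; rewrite !in_itv/= => /andP[/ltW -> /ltW ->].
Qed.

(** By Jacobi's formula the left-hand side is the derivative of det g = 1. Its
imaginary part says that the velocity is orthogonal to i * g, the direction in
which all eigenvalues turn together. *)
Lemma velocity_trace (t : R) : t \in `]0, 1[ ->
  \sum_i \sum_j Num.conj (g t i j) * v t i j = 0.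
Proof.
move=> t01.
have := @is_cderive_det R N g (v t) t (is_cderive_velocity gC t).
move=> /(@is_cderive_near_cst R _ 1) /= E.
rewrite -[RHS]E; last by apply: filterS (near_SU t01) => s [].
have SUt : SU N (g t) by exact: nbhs_singleton (near_SU t01).
apply: eq_bigr => i _; apply: eq_bigr => j _.
by rewrite unitary_cofactor// mulrC.
Qed.

(** The columns have norm 1, so each of them moves orthogonally to itself. *)
Lemma velocity_col (t : R) j : t \in `]0, 1[ ->
  complex.Re (\sum_i Num.conj (g t i j) * v t i j) = 0.
Proof.
move=> t01.
have : is_cderive (fun s => \sum_i Num.conj (g s i j) * g s i j) t
    (\sum_i (Num.conj (v t i j) * g t i j + Num.conj (g t i j) * v t i j)).
  apply: is_cderive_sum => i; have d := is_cderive_velocity gC t i j.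
  exact: is_cderiveM (is_cderive_conj d) d.
move=> /(@is_cderive_near_cst R _ 1) E.
have {}E := E (filterS _ (near_SU t01)).
have /(congr1 (@complex.Re R)) : \sum_i (Num.conj (v t i j) * g t i j +
    Num.conj (g t i j) * v t i j) = 0.
  by apply: E => s [sU _]; exact: unitary_col_normsq.
rewrite Re_sum [RHS]/= => E1; rewrite Re_sum.
apply: (@mulIf _ 2); first by rewrite pnatr_eq0.
rewrite mul0r -[RHS]E1 mulr_suml; apply: eq_bigr => i _.
by rewrite ReD !ReM !conjCE /=; ring.
Qed.

Definition speed t := Num.sqrt (\sum_i \sum_j normsq (v t i j)).

Lemma continuous_speed : continuous speed.
Proof.
move=> t; apply: (@continuous_comp _ _ _ (fun s => \sum_i \sum_j normsq (v s i j)));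
  last exact: sqrt_continuous.
apply: cvg_big => [|i _]; first exact: add_continuous.
apply: cvg_big => [|j _]; first exact: add_continuous.
have [[_ cr] [_ ci]] := gC i j.
have -> : (fun s => normsq (v s i j)) = (fun s =>
    derive1 (fun s => complex.Re (g s i j)) s ^+ 2 +
    derive1 (fun s => complex.Im (g s i j)) s ^+ 2).
  by apply/funext => s; rewrite /normsq !mxE.
rewrite /normsq !mxE /=; apply: cvgD.
  by apply: (@continuous_comp _ _ _ _ (fun x : R => x ^+ 2)); [exact: cr|exact: exprn_continuous].
by apply: (@continuous_comp _ _ _ _ (fun x : R => x ^+ 2)); [exact: ci|exact: exprn_continuous].
Qed.

Lemma curve_length_speed : curve_length g = \int[lebesgue_measure]_(t in `[0, 1]) speed t.
Proof.
apply: eq_Rintegral => t; rewrite inE/= => t01.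
by rewrite hs_norm_unitary//; have [] := gSU t01.
Qed.

(** The primitive starts at -1, rather than 0, so that it is differentiable
on both sides at every point of [0, 1]. *)
Definition arc (t : R) := \int[lebesgue_measure]_(s in `[(-1)%R, t]) speed s.

Lemma integrable_speed (a b : R) :
  (@lebesgue_measure R).-integrable `[a, b] (EFin \o speed).
Proof.
apply: continuous_compact_integrable; first exact: segment_compact.
exact/continuous_subspaceT/continuous_speed.
Qed.

Lemma is_derive_arc (t : R) : t \in `[0, 1] -> is_derive t 1 arc (speed t).
Proof.
rewrite in_itv/= => /andP[t0 t1].
have [] := @continuous_FTC1_closed R speed (-1) t 2.
- by rewrite (le_lt_trans t1)// ltr1n.
- exact: integrable_speed.
- by rewrite (lt_le_trans _ t0)// ltrN10.
- exact: continuous_speed.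
by move=> da dE; split; [exact: da|rewrite -derive1E].
Qed.

Lemma arcB : arc 1 - arc 0 = curve_length g.
Proof.
rewrite curve_length_speed /arc (@Rintegral_itvB R speed).
- rewrite Rintegral_itv_obnd_cbnd//.
  apply: integrableS (integrable_speed 0 1) => //.
  exact: subset_itv_oc_cc.
- exact: integrable_speed.
- by rewrite bnd_simp lerN10.
- by rewrite bnd_simp ler01.
Qed.

End CurveLowerBound.

(** * A lower bound for the length of a curve in SU(N) *)
Section TwistedCurve.
Context {R : realType} (N : nat).
Implicit Types (x y : 'I_N -> R).

(** Since b is orthogonal to a, the coordinate of b along e is unchanged when
e is replaced by its component orthogonal to a, whose squared norm is 1 - r ^+ 2,
where r is the coordinate of a along e. *)
Lemma tangent_coord_le (e : R[i]) (a b : 'I_N -> R[i]) (j : 'I_N) :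
  normsq e = 1 -> \sum_i normsq (a i) = 1 ->
  complex.Re (\sum_i Num.conj (a i) * b i) = 0 ->
  complex.Re (Num.conj e * b j) ^+ 2 <=
  (\sum_i normsq (b i)) * (1 - complex.Re (Num.conj e * a j) ^+ 2).
Proof.
move=> e1 a1 ab0; set r := complex.Re (Num.conj e * a j).
have := cauchy_schwarz_complex (fun i => e *+ (i == j) - r%:C * a i) b.
have -> : \sum_i Num.conj (e *+ (i == j) - r%:C * a i) * b i =
    Num.conj e * b j - r%:C * \sum_i Num.conj (a i) * b i.
  rewrite mulr_sumr -(sum_delta j (fun i => Num.conj e * b i)) -sumrB.
  apply: eq_bigr => i _; rewrite rmorphB rmorphM rmorphMn/= mulrBl mulrA mulrnAl.
  by congr (_ - _ * _ * _); rewrite conjCE /= oppr0.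
have -> : \sum_i normsq (e *+ (i == j) - r%:C * a i) = 1 - r ^+ 2.
  under eq_bigr do rewrite normsqB_scale.
  rewrite big_split big_split /= sumrN sumrMnl -!mulr_sumr a1 mulr1.
  have -> : \sum_i normsq (e *+ (i == j)) = 1.
    rewrite -e1 -[RHS](sum_delta j (fun=> normsq e)); apply: eq_bigr => i _.
    by case: (i == j); rewrite ?mulr1n// !mulr0n /normsq /= expr0n addr0.
  have -> : \sum_i complex.Re (Num.conj (e *+ (i == j)) * a i) = r.
    rewrite -[RHS](sum_delta j (fun i => complex.Re (Num.conj e * a i))).
    apply: eq_bigr => i _.
    by case: (i == j); rewrite ?mulr1n// !mulr0n conjC0 mul0r.
  by ring.
have -> : complex.Re (Num.conj e * b j - r%:C * \sum_i Num.conj (a i) * b i) =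
    complex.Re (Num.conj e * b j).
  by rewrite ReD ReN [complex.Re (r%:C * _)]ReM ab0 mulr0 [complex.Im r%:C]/= mul0r !subr0.
by rewrite [X in _ <= X -> _]mulrC.
Qed.

Lemma unitary_normsq_col (U : 'M[R[i]]_N) j : U \is unitarymx ->
  \sum_i normsq (U i j) = 1.
Proof.
move=> /(unitary_col_normsq j) /(congr1 (@complex.Re R)) /= <-.
by rewrite Re_sum; apply: eq_bigr => i _; rewrite mulrC normsq_conj.
Qed.

(** Twist the curve by the scalars exp(- i c S(t)), where the clock S is the
normalized arc length. Column j of the twisted curve moves on the unit sphere
and turns by the angle y j - x j - c, at most pi in absolute value, so its
length is at least that angle; hence the squared length of the twisted curve is
at least the sum of (y j - x j - c) ^+ 2, that is the sum of (y j - x j) ^+ 2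
plus N * c ^+ 2. Conversely [velocity_trace] makes the velocity orthogonal to
the twist, so the squared length of the twisted curve is L ^+ 2 + N * c ^+ 2.
Without the twist the argument fails for angles larger than pi. *)
Lemma SU_curve_length_ge x y (c : R) (g : R -> 'M[R[i]]_N) :
  SU_curve (diag_cis x) (diag_cis y) g ->
  \sum_j (y j - x j) = 0 -> (forall j, `|y j - x j - c| <= pi) ->
  \sum_j (y j - x j) ^+ 2 <= curve_length g ^+ 2.
Proof.
move=> [gC gSU g0 g1] sum0 dc.
set L := curve_length g; have L0 : 0 <= L := curve_length_ge0 g.
(* Adding e to the speed makes the clock run even along a constant curve. *)
suff H (e : R) : 0 < e -> \sum_j (y j - x j) ^+ 2 <= (L + e) ^+ 2.
  apply: (@ler_cvg_to _ (0 : R)^'+ _ _ (cst (\sum_j (y j - x j) ^+ 2))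
    (fun e => (L + e) ^+ 2)).
  - exact: cvg_cst.
  - apply: cvg_at_right_filter.
    rewrite (_ : nbhs (L ^+ 2) = nbhs ((L + 0) ^+ 2)); last by rewrite addr0.
    apply: (@continuous_comp _ _ _ (fun e => L + e) (fun x : R => x ^+ 2)).
      by apply: cvgD; [exact: cvg_cst|exact: cvg_id].
    exact: exprn_continuous.
  near=> e; apply: H; near: e; exact: nbhs_right_gt.
move=> e0; set M := L + e; have M0 : 0 < M by rewrite ltr_wpDl.
pose S t := (arc g t - arc g 0 + e * t) / M.
pose dS t := (speed g t + e) / M.
have S_derive (t : R) : t \in `[0, 1] -> is_derive t 1 S (dS t).
  move=> t01; have := is_derive_arc gC t01 => ?.
  have -> : S = fun t => M^-1 * (arc g t - arc g 0 + e * t).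
    by apply/funext => s; rewrite /S mulrC.
  apply: is_derive_eq.
  by rewrite /dS /GRing.scale /= mulrC ?mulr0 ?addr0 ?subr0 ?mulr1 ?add0r.
have dS0 t : 0 < dS t by rewrite divr_gt0// ltr_wpDl// sqrtr_ge0.
pose ph j t := cis (x j + c * S t).
pose W j t i := velocity g t i j - (c * dS t)%:C * ('i * g t i j).
pose r j t := complex.Re (Num.conj (ph j t) * g t j j).
pose dr j t := complex.Re (Num.conj (ph j t) * W j t j).
pose w j t := Num.sqrt (\sum_i normsq (W j t i)).
have oc (t : R) : t \in `]0, 1[ -> t \in `[0, 1].
  by rewrite !in_itv/= => /andP[/ltW -> /ltW ->].
have r_derive j (t : R) : t \in `[0, 1] -> is_derive t 1 (r j) (dr j t).
  move=> t01.
  have [+ _] : is_cderive (fun s => Num.conj (ph j s) * g s j j) t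
      (Num.conj (ph j t) * W j t j).
    have -> : Num.conj (ph j t) * W j t j =
      Num.conj ((c * dS t)%:C * 'i * ph j t) * g t j j + Num.conj (ph j t) * velocity g t j j.
      rewrite /W; move: (c * dS t) (ph j t) (g t j j) (velocity g t j j) => k.
      move=> [p1 p2] [q1 q2] [v1 v2].
      by apply: complex_ext => /=; ring.
    apply: is_cderiveM; last exact: is_cderive_velocity.
    apply/is_cderive_conj/is_cderive_cis.
    have := S_derive _ t01 => ?; apply: is_derive_eq.
    by rewrite /GRing.scale /= ?mulr0 ?add0r ?addr0 ?mul1r.
  exact.
have gU (t : R) : t \in `[0, 1] -> g t \is unitarymx.
  by move=> /gSU[].
have W_orth j (t : R) : t \in `]0, 1[ ->
    complex.Re (\sum_i Num.conj (g t i j) * W j t i) = 0.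
  move=> t01; rewrite Re_sum.
  transitivity (complex.Re (\sum_i Num.conj (g t i j) * velocity g t i j)).
    rewrite Re_sum; apply: eq_bigr => i _.
    rewrite /W mulrBr ReD ReN; set z := g t i j.
    suff -> : complex.Re (Num.conj z * ((c * dS t)%:C * ('i * z))) = 0 by rewrite subr0.
    by case: z => a b /=; ring.
  exact: velocity_col.
have r_sq j (t : R) : t \in `[0, 1] -> normsq (g t j j) <= 1.
  move=> t01; rewrite -(unitary_normsq_col j (gU _ t01)) (bigD1 j)//= lerDl.
  by apply: sumr_ge0 => i _; exact: normsq_ge0.
have Mc0 : 0 <= M ^+ 2 + c ^+ 2 * N%:R.
  by apply: addr_ge0; [exact: sqr_ge0|apply: mulr_ge0; [exact: sqr_ge0|exact: ler0n]].
pose al j : R := y j - x j - c; pose K : R := Num.sqrt (M ^+ 2 + c ^+ 2 * N%:R).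
suff : \sum_j al j ^+ 2 <= K ^+ 2.
  rewrite sqr_sqrtr//.
  have -> : \sum_j (y j - x j - c) ^+ 2 = \sum_j (y j - x j) ^+ 2 + c ^+ 2 * N%:R.
    under eq_bigr do rewrite sqrrB.
    rewrite !big_split /= sumr_const card_ord sumrN sumrMnl -mulr_suml sum0.
    by rewrite mul0r mul0rn subr0 mulr_natr.
  by rewrite lerD2r.
have H := @sphere_arc_le R N r dr w S dS al K
  (fun j t t01 => r_derive j t (oc t t01)) (fun t t01 => S_derive t (oc t t01)).
apply: H; last exact: dc.
- move=> j t t01; have [d _] := r_derive j t t01.
  exact/differentiable_continuous/derivable1_diffP.
- move=> j t t01; rewrite -(@expr_le1 _ 2)// real_normK ?num_real//.
  have := @cauchy_schwarz_complex R 'I_1 (fun=> ph j t) (fun=> g t j j).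
  rewrite !big_ord1 normsq_cis mul1r => /le_trans; apply.
  exact: r_sq.
- by move=> j t; exact: sqrtr_ge0.
- move=> j t t01; rewrite sqr_sqrtr ?sumr_ge0// => [|i _]; last exact: normsq_ge0.
  apply: (@tangent_coord_le (ph j t) (fun i => g t i j)).
  + exact: normsq_cis.
  + exact/unitary_normsq_col/gU/oc.
  + exact: W_orth.
- move=> t t01; have [d _] := S_derive t t01.
  exact/differentiable_continuous/derivable1_diffP.
- by move=> t _; exact: ltW.
- by rewrite sqrtr_ge0.
- move=> t t01; rewrite exprMn sqr_sqrtr//.
  have -> : \sum_j w j t ^+ 2 = speed g t ^+ 2 + (c * dS t) ^+ 2 * N%:R.
    rewrite sqr_sqrtr; last first.
      by do 2 (apply: sumr_ge0 => ? _); exact: normsq_ge0.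
    have -> : \sum_j w j t ^+ 2 = \sum_j \sum_i normsq (W j t i).
      apply: eq_bigr => j _; rewrite sqr_sqrtr// sumr_ge0// => i _; exact: normsq_ge0.
    rewrite [in RHS]exchange_big /=.
    have E : \sum_j \sum_i complex.Re (Num.conj (velocity g t i j) * ('i * g t i j)) = 0.
      rewrite exchange_big /=.
      transitivity (complex.Im (\sum_i \sum_j Num.conj (g t i j) * velocity g t i j)).
        rewrite Im_sum; apply: eq_bigr => i _; rewrite Im_sum; apply: eq_bigr => j _.
        by rewrite !conjCE; case: (g t i j) => a b; case: (velocity g t i j) => a' b' /=; ring.
      by rewrite velocity_trace.
    have E1 : \sum_j \sum_i normsq ('i * g t i j) = N%:R.
      rewrite -[in RHS](card_ord N) -sumr_const; apply: eq_bigr => j _.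
      rewrite -(unitary_normsq_col j (gU _ (oc _ t01))); apply: eq_bigr => i _.
      by case: (g t i j) => a b; rewrite /normsq /=; ring.
    rewrite -E1 -[RHS]subr0.
    rewrite [X in _ - X](_ : 0 = (c * dS t) *+ 2 *
        \sum_j \sum_i complex.Re (Num.conj (velocity g t i j) * ('i * g t i j))).
      2: by rewrite E mulr0.
    rewrite !mulr_sumr -big_split -sumrB /=; apply: eq_bigr => j _.
    rewrite !mulr_sumr -big_split -sumrB /=; apply: eq_bigr => i _.
    by rewrite normsqB_scale; ring.
  have -> : (M ^+ 2 + c ^+ 2 * N%:R) * dS t ^+ 2 =
      (M * dS t) ^+ 2 + (c * dS t) ^+ 2 * N%:R by ring.
  rewrite lerD2r ler_sqr ?nnegrE ?sqrtr_ge0//; last first.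
    by apply: mulr_ge0; exact: ltW.
  by rewrite /dS mulrC divfK ?gt_eqF// lerDl ltW.
- by rewrite /S subrr mulr0 addr0 mul0r.
- by rewrite /S arcB// mulr1 divff ?gt_eqF.
- move=> j; rewrite /r g0 diag_cisE eqxx mulr1n /ph /S subrr mulr0 addr0 mul0r mulr0 addr0.
  by rewrite mulrC normsq_conj normsq_cis.
- move=> j; rewrite /r g1 diag_cisE eqxx mulr1n /ph /S arcB// mulr1 divff ?gt_eqF// mulr1.
  by rewrite conj_cis -cisD /= addrC opprD addrA.
Unshelve. all: by end_near. Qed.

End TwistedCurve.

(** * Geodesics and traces of diagonal matrices *)
Section DiagonalGeodesic.
Context {R : realType} (N : nat).
Implicit Types (x y : 'I_N -> R).

Definition diag_geodesic x y (t : R) : 'M[R[i]]_N :=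
  diag_cis (fun j => x j + t * (y j - x j)).

Lemma is_cderive_diag_geodesic x y t i j :
  is_cderive (fun s => diag_geodesic x y s i j) t
    (((y i - x i)%:C * 'i * cis (x i + t * (y i - x i))) *+ (i == j)).
Proof.
under [X in is_cderive X]eq_fun do rewrite diag_cisE.
case: (i == j); last first.
  under [X in is_cderive X]eq_fun do rewrite mulr0n.
  exact: is_cderive_cst.
under [X in is_cderive X]eq_fun do rewrite mulr1n.
rewrite mulr1n; apply: is_cderive_cis.
apply: is_derive_eq.
by rewrite /GRing.scale /= ?mulr0 ?add0r ?addr0 ?mulr1 ?mul1r.
Qed.

Lemma C1_is_derive (u du : R -> R) : (forall t : R, is_derive t 1 u (du t)) ->
  continuous du -> C1 u.
Proof.
move=> d cdu; split=> [t|]; first by have [] := d t.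
suff -> : derive1 u = du by [].
by apply/funext => t; rewrite derive1E; have [_ ->] := d t.
Qed.

Lemma continuous_sin_affine (k a b : R) : continuous (fun t : R => k * sin (a + t * b)).
Proof.
move=> t; apply: cvgM; first exact: cvg_cst.
apply: (@continuous_comp _ _ _ (fun t : R => a + t * b) sin); last exact: continuous_sin.
by apply: cvgD; [exact: cvg_cst|apply: cvgM; [exact: cvg_id|exact: cvg_cst]].
Qed.

Lemma continuous_cos_affine (k a b : R) : continuous (fun t : R => k * cos (a + t * b)).
Proof.
move=> t; apply: cvgM; first exact: cvg_cst.
apply: (@continuous_comp _ _ _ (fun t : R => a + t * b) cos); last exact: continuous_cos.
by apply: cvgD; [exact: cvg_cst|apply: cvgM; [exact: cvg_id|exact: cvg_cst]].
Qed.

Lemma diag_geodesic_curve x y : \sum_j x j = 0 -> \sum_j y j = 0 ->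
  SU_curve (diag_cis x) (diag_cis y) (diag_geodesic x y).
Proof.
move=> x0 y0; split.
- move=> i j; split; apply: C1_is_derive => [t|].
  + by have [d _] := is_cderive_diag_geodesic x y t i j; exact: d.
  + case: (i == j) => /=.
      rewrite (_ : (fun _ => _) = fun t => - (y i - x i) * sin (x i + t * (y i - x i))).
        exact: continuous_sin_affine.
      by apply/funext => t /=; ring.
    exact: cst_continuous.
  + by have [_ d] := is_cderive_diag_geodesic x y t i j; exact: d.
  + case: (i == j) => /=.
      rewrite (_ : (fun _ => _) = fun t => (y i - x i) * cos (x i + t * (y i - x i))).
        exact: continuous_cos_affine.
      by apply/funext => t /=; ring.
    exact: cst_continuous.
- move=> t _; apply: SU_diag_cis.
  by rewrite big_split /= -mulr_sumr sumrB x0 y0 subr0 mulr0 addr0.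
- by congr diag_cis; apply/funext => j; rewrite mul0r addr0.
- by congr diag_cis; apply/funext => j; rewrite mul1r addrC subrK.
Qed.

Lemma diag_geodesic_length x y : \sum_j x j = 0 -> \sum_j y j = 0 ->
  curve_length (diag_geodesic x y) = Num.sqrt (\sum_j (y j - x j) ^+ 2).
Proof.
move=> x0 y0; have [C SUg _ _] := diag_geodesic_curve x0 y0.
rewrite curve_length_speed//.
transitivity (\int[@lebesgue_measure R]_(t in `[0, 1]) Num.sqrt (\sum_j (y j - x j) ^+ 2)).
  apply: eq_Rintegral => t _; rewrite /speed; congr Num.sqrt.
  apply: eq_bigr => i _; rewrite -[RHS](sum_delta i (fun=> (y i - x i) ^+ 2)).
  apply: eq_bigr => j _.
  have <- := is_cderive_unique (is_cderive_diag_geodesic x y t i j)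
    (is_cderive_velocity C t i j).
  rewrite eq_sym; case: (j == i) => /=; last by rewrite /normsq /=; ring.
  rewrite !mulr1n /normsq/=.
  set a := x i + _; have := cos2Dsin2 a; move: (cos a) (sin a) => u v uv.
  by transitivity ((y i - x i) ^+ 2 * (u ^+ 2 + v ^+ 2)); [ring|rewrite uv mulr1].
rewrite Rintegral_cst//= lebesgue_measure_itv/= lte_fin ltr01.
by rewrite oppr0 adde0 mulr1.
Qed.

(** If the displacements differ by at most 2 * pi, the shift c of
[SU_curve_length_ge] can be the largest displacement minus pi. The straight
segment between the angles attains the lower bound. *)
Lemma geodesic_dist_diag_cis x y : \sum_j x j = 0 -> \sum_j y j = 0 ->
  (forall i j, (y i - x i) - (y j - x j) <= 2 * pi) ->
  geodesic_dist (diag_cis x) (diag_cis y) = Num.sqrt (\sum_j (y j - x j) ^+ 2).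
Proof.
move=> x0 y0 window.
have [c dc] : exists c, forall j, `|y j - x j - c| <= pi.
  move: window; rewrite /diag_cis; case: (N) x y {x0 y0} => [|n] x y window.
    by exists 0; case.
  have [m mmax] : exists m, forall j, y j - x j <= y m - x m.
    exists [arg max_(i > ord0) (y i - x i)%R]%O.
    by case: arg_maxP => // k _ kmax j; exact: kmax.
  exists (y m - x m - pi) => j.
  have := mmax j; have := window m j => h1 h2.
  by rewrite ler_norml; lra.
apply/eqP; rewrite eq_le; apply/andP; split.
  rewrite -diag_geodesic_length//; apply: ge_inf.
    by exists 0 => _ [g _ <-]; exact: curve_length_ge0.
  by exists (diag_geodesic x y) => //; exact: diag_geodesic_curve.
apply: lb_le_inf.
  by exists (curve_length (diag_geodesic x y)), (diag_geodesic x y) => //; exact: diag_geodesic_curve.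
move=> _ [g gxy <-].
rewrite -[leRHS](ger0_norm (curve_length_ge0 g)) -sqrtr_sqr ler_wsqrtr//.
apply: SU_curve_length_ge gxy _ dc.
by rewrite sumrB x0 y0 subr0.
Qed.

(** The two halves of the segment satisfy the hypotheses of the distance
formula too, because their displacements are those of the whole segment scaled
by theta and 1 - theta. *)
Lemma diag_geodesic_Zset (theta : R) x y : 0 <= theta <= 1 ->
  \sum_j x j = 0 -> \sum_j y j = 0 ->
  (forall i j, (y i - x i) - (y j - x j) <= 2 * pi) ->
  Zset theta (diag_cis x) (diag_cis y) (diag_geodesic x y theta).
Proof.
move=> /andP[th0 th1] x0 y0 window.
pose z j := x j + theta * (y j - x j).
have z0 : \sum_j z j = 0.
  by rewrite big_split /= -mulr_sumr sumrB x0 y0 subr0 mulr0 addr0.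
have zx j : z j - x j = theta * (y j - x j) by rewrite /z; ring.
have yz j : y j - z j = (1 - theta) * (y j - x j) by rewrite /z; ring.
have piR : 0 <= 2 * pi :> R by rewrite mulr_ge0// pi_ge0.
split; first exact: SU_diag_cis.
  rewrite !geodesic_dist_diag_cis// => [|i j].
    under eq_bigr do rewrite zx exprMn.
    by rewrite -mulr_sumr sqrtrM ?sqr_ge0// sqrtr_sqr ger0_norm.
  rewrite !zx -mulrBr; have := window i j; nra.
rewrite !geodesic_dist_diag_cis// => [|i j].
  under eq_bigr do rewrite yz exprMn.
  by rewrite -mulr_sumr sqrtrM ?sqr_ge0// sqrtr_sqr ger0_norm// subr_ge0.
rewrite !yz -mulrBr; have := window i j; nra.
Qed.

End DiagonalGeodesic.

Section TraceDiagonal.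
Context {R : realType}.

Lemma char_poly_conj (n : nat) (P D : 'M[R[i]]_n) : P \in unitmx ->
  char_poly (invmx P *m D *m P) = char_poly D.
Proof.
move=> Pu; rewrite /char_poly.
have -> : char_poly_mx (invmx P *m D *m P) =
    map_mx polyC (invmx P) *m char_poly_mx D *m map_mx polyC P.
  rewrite /char_poly_mx !map_mxM mulmxBr mulmxBl /=; congr (_ - _).
  by rewrite mul_mx_scalar -scalemxAl -map_mxM mulVmx//= map_mx1 scalemx1.
rewrite !det_mulmx mulrAC -det_mulmx -map_mxM mulVmx//= map_mx1 det1.
by rewrite mul1r.
Qed.

Lemma char_poly_diag (n : nat) (d : 'rV[R[i]]_n) :
  char_poly (diag_mx d) = \prod_i ('X - (d 0 i)%:P).
Proof.
rewrite char_poly_trig ?diag_mx_is_trig//.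
by apply: eq_bigr => i _; rewrite mxE eqxx mulr1n.
Qed.

Lemma norm_cis (t : R) : cis t \in (@unit_circle R).
Proof.
rewrite inE /unit_circle /= normc_def /=.
by rewrite cos2Dsin2 sqrtr1.
Qed.

(** The default value circle1 is never reached, as cis t has norm 1. The
definition uses [insubd] so as to match the functional calculus. *)
Definition circ (t : R) : circle R := insubd circle1 (cis t).

Lemma val_circ t : set_val (circ t) = cis t.
Proof. exact: (insubdK circle1 (norm_cis t)). Qed.

(** The spectral decomposition of a diagonal matrix lists its diagonal entries
in an unspecified order; comparing characteristic polynomials shows that the
two lists are permutations of each other. *)
Lemma trace_fun_diag_cis (N : nat) (f : circle R -> R) (x : 'I_N -> R) :
  trace_fun f (diag_cis x) = \sum_j f (circ (x j)).
Proof.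
set U := diag_cis x.
have nU : U \is normalmx.
  apply/normalmxP; rewrite /U /diag_cis tr_diag_mx map_diag_mx.
  by rewrite !mulmx_diag; congr diag_mx; apply/rowP => j; rewrite !mxE mulrC.
have /orthomx_spectralP UE := nU.
have Pu := spectral_unit U.
have perm : perm_eq [seq spectral_diag U 0 i | i <- index_enum 'I_N] [seq cis (x i) | i <- index_enum 'I_N].
  apply: prod_XsubC_eq; rewrite !big_map.
  rewrite -char_poly_diag -(char_poly_conj (diag_mx (spectral_diag U)) Pu) -UE.
  by rewrite char_poly_diag; apply: eq_bigr => i _; rewrite mxE.
rewrite /trace_fun /fun_calculus mxtrace_mulC mulmxA mulmxV// mul1mx mxtrace_diag Re_sum.
transitivity (\sum_(z <- [seq spectral_diag U 0 i | i <- index_enum 'I_N]) f (insubd circle1 z)).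
  by rewrite big_map; apply: eq_bigr => i _; rewrite mxE.
by rewrite (perm_big _ perm) /= big_map.
Qed.

End TraceDiagonal.

(** * Convexity of the logarithmic kernel on an arc *)

Section LogSinConvex.
Context {R : realType}.
Implicit Types (s u v : R).

(** With s half of the angle between two points of the circle, the logarithmic
energy of the pair minus the quadratic term that convexity can still absorb:
the second derivative of - ln sin is 1 / sin ^+ 2, which is at least 1. *)
Definition log_sin s := - ln (sin s) - s ^+ 2 / 2.

Let dlog_sin s := - (cos s / sin s) - s.

Lemma is_derive_log_sin s : 0 < s < pi -> is_derive s 1 log_sin (dlog_sin s).
Proof.
move=> spi; have s0 : 0 < sin s by exact: sin_gt0_pi.
have := @is_derive1_comp R (@ln R) sin s _ _ (is_derive1_ln s0) (is_derive_sin s) => ?.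
rewrite /log_sin /dlog_sin.
apply: is_derive_eq.
rewrite /GRing.scale /=; field.
by rewrite gt_eqF.
Qed.

Lemma dlog_sin_mono (a b : R) : 0 < a -> a <= b -> b < pi ->
  dlog_sin a <= dlog_sin b.
Proof.
move=> a0; rewrite le_eqVlt => /predU1P[->//|ab] bpi.
pose dd s := (sin s ^+ 2)^-1 - 1.
have D s : 0 < s < pi -> is_derive s 1 dlog_sin (dd s).
  move=> spi; have s0 : 0 < sin s by exact: sin_gt0_pi.
  have sn : sin s != 0 by rewrite gt_eqF.
  have := is_deriveV sn (is_derive_sin s) => ?.
  rewrite /dlog_sin; apply: is_derive_eq.
  transitivity ((cos s ^+ 2 + sin s ^+ 2) / sin s ^+ 2 - 1).
    by rewrite /GRing.scale /=; field.
  by rewrite cos2Dsin2 mul1r.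
have [||c cab E] := @MVT R dlog_sin dd a b ab.
- move=> s; rewrite in_itv/= => /andP[sa sb].
  by apply: D; rewrite (lt_trans a0 sa) (lt_trans sb bpi).
- apply: derivable_within_continuous => s; rewrite in_itv/= => /andP[sa sb].
  have [d _] : is_derive s 1 dlog_sin (dd s); last exact: d.
  by apply: D; rewrite (lt_le_trans a0 sa) (le_lt_trans sb bpi).
rewrite -subr_ge0 E; apply: mulr_ge0; last by rewrite subr_ge0 ltW.
move: cab; rewrite in_itv/= => /andP[ca cb].
have c0 : 0 < sin c by apply: sin_gt0_pi; rewrite (lt_trans a0 ca) (lt_trans cb bpi).
by rewrite /dd subr_ge0 invf_ge1 ?exprn_gt0//.
Qed.

(** The mean value theorem on both sides of the interpolated point reduces
convexity to the monotonicity of the derivative. *)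
Lemma log_sin_convex (theta u v : R) : 0 <= theta <= 1 -> 0 < u < pi -> 0 < v < pi ->
  log_sin ((1 - theta) * u + theta * v) <=
  (1 - theta) * log_sin u + theta * log_sin v.
Proof.
wlog uv : theta u v / u <= v => [H th u0 v0|].
  have [uv|/ltW vu] := leP u v; first exact: H.
  have th' : 0 <= 1 - theta <= 1.
    by rewrite subr_ge0 lerBlDr lerDl andbC.
  by have := H (1 - theta) v u vu th' v0 u0; rewrite subKr addrC [X in _ <= X]addrC.
move=> /andP[th0 th1] /andP[u0 upi] /andP[v0 vpi].
have [->|un] := eqVneq u v.
  have -> : (1 - theta) * v + theta * v = v by ring.
  by have -> : (1 - theta) * log_sin v + theta * log_sin v = log_sin v by ring.
have {uv un}uv : u < v by rewrite lt_neqAle un.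
have [->|t0] := eqVneq theta 0; first by rewrite !mul0r !addr0 subr0 !mul1r.
have [->|t1] := eqVneq theta 1; first by rewrite subrr !mul0r !add0r !mul1r.
have {t0}th0 : 0 < theta by rewrite lt_neqAle eq_sym t0.
have {t1}th1 : theta < 1 by rewrite lt_neqAle t1.
set w := (1 - theta) * u + theta * v.
have uw : u < w by rewrite /w; nra.
have wv : w < v by rewrite /w; nra.
have mv a b : 0 < a -> a < b -> b < pi ->
    exists2 c, a < c < b & log_sin b - log_sin a = dlog_sin c * (b - a).
  move=> a0 ab bpi.
  have [||c cab E] := @MVT R log_sin dlog_sin a b ab.
  - move=> s; rewrite in_itv/= => /andP[sa sb].
    by apply: is_derive_log_sin; rewrite (lt_trans a0 sa) (lt_trans sb bpi).
  - apply: derivable_within_continuous => s; rewrite in_itv/= => /andP[sa sb].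
    have [d _] : is_derive s 1 log_sin (dlog_sin s); last exact: d.
    by apply: is_derive_log_sin; rewrite (lt_le_trans a0 sa) (le_lt_trans sb bpi).
  by exists c.
have [c1 /andP[uc1 c1w] E1] := mv u w u0 uw (lt_trans wv vpi).
have [c2 /andP[wc2 c2v] E2] := mv w v (lt_trans u0 uw) wv vpi.
have M := dlog_sin_mono (lt_trans u0 uc1) (ltW (lt_trans c1w wc2)) (lt_trans c2v vpi).
rewrite -subr_ge0.
have -> : (1 - theta) * log_sin u + theta * log_sin v - log_sin w =
   theta * (log_sin v - log_sin w) - (1 - theta) * (log_sin w - log_sin u) by ring.
have -> : log_sin v - log_sin w = dlog_sin c2 * ((1 - theta) * (v - u)).
  by rewrite E2 /w; ring.
have -> : log_sin w - log_sin u = dlog_sin c1 * (theta * (v - u)).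
  by rewrite E1 /w; ring.
have -> : theta * (dlog_sin c2 * ((1 - theta) * (v - u))) -
   (1 - theta) * (dlog_sin c1 * (theta * (v - u))) =
   theta * (1 - theta) * (v - u) * (dlog_sin c2 - dlog_sin c1) by ring.
by rewrite !mulr_ge0 ?subr_ge0 ?(ltW th0) ?(ltW th1) ?(ltW uv).
Qed.

Local Open Scope ereal_scope.

(** Logarithmic energy of two points at angular distance u, normalized by the
diameter 2 of the circle so that it is nonnegative; it is +oo when the points
coincide. *)
Definition arc_energy u : \bar R := - lne `|sin (u / 2)|%:E.

Lemma arc_energy_ge0 u : 0 <= arc_energy u.
Proof.
by rewrite /arc_energy leeNr oppe0 lne_le0 lee_fin ler_norml sin_geN1 sin_le1.
Qed.

Lemma arc_energyN u : arc_energy (- u) = arc_energy u.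
Proof. by rewrite /arc_energy mulNr sinN normrN. Qed.

Lemma arc_energy_interior u : (0 < u < 2 * pi)%R ->
  arc_energy u = (log_sin (u / 2) + u ^+ 2 / 8)%:E /\ (0 < u / 2 < pi)%R.
Proof.
move=> /andP[u0 u1].
have h : (0 < u / 2 < pi)%R by apply/andP; split; lra.
split=> //; have s0 := sin_gt0_pi h.
rewrite /arc_energy gtr0_norm// lne_EFin// -EFinN; congr EFin.
by rewrite /log_sin; field.
Qed.

Lemma arc_energy_boundary u : (0 <= u <= 2 * pi)%R -> ~~ (0 < u < 2 * pi)%R ->
  arc_energy u = +oo.
Proof.
move=> /andP[u0 u1]; rewrite negb_and -!leNgt => h.
suff s0 : sin (u / 2) = 0%R by rewrite /arc_energy s0 normr0 /= lexx.
case/orP: h => h.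
  have -> : u = 0%R by apply/eqP; rewrite eq_le h u0.
  by rewrite mul0r sin0.
have -> : u = (2 * pi)%R by apply/eqP; rewrite eq_le h u1.
by rewrite mulrAC divff ?mul1r ?sinpi// pnatr_eq0.
Qed.

(** At the ends of [0, 2 * pi] the right-hand side is infinite, because
theta and 1 - theta are both positive. *)
Lemma arc_energy_convex (theta u v : R) : (0 < theta < 1)%R ->
  (0 <= u <= 2 * pi)%R -> (0 <= v <= 2 * pi)%R ->
  arc_energy ((1 - theta) * u + theta * v) +
    (theta * (1 - theta) / 8 * (u - v) ^+ 2)%:E <=
  (1 - theta)%:E * arc_energy u + theta%:E * arc_energy v.
Proof.
move=> /andP[th0 th1] u2 v2.
have th1' : (0 < 1 - theta)%R by rewrite subr_gt0.
have mge0 (a : R) b : (0 < a)%R -> a%:E * arc_energy b != -oo.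
  by move=> a0; rewrite -ltNye (lt_le_trans ltNy0)// mule_ge0 ?lee_fin ?(ltW a0)// arc_energy_ge0.
have [u0|u0] := boolP (0 < u < 2 * pi)%R; last first.
  by rewrite (arc_energy_boundary u2 u0) gt0_muley ?lte_fin// addye ?leey ?mge0.
have [v0|v0] := boolP (0 < v < 2 * pi)%R; last first.
  by rewrite (arc_energy_boundary v2 v0) gt0_muley ?lte_fin// addey ?leey ?mge0.
have [-> hu] := arc_energy_interior u0.
have [-> hv] := arc_energy_interior v0.
have w0 : (0 < (1 - theta) * u + theta * v < 2 * pi)%R.
  move: u0 v0 => /andP[a b] /andP[c d]; apply/andP; split; nra.
have [-> _] := arc_energy_interior w0.
rewrite -!EFinM -!EFinD lee_fin.
have := @log_sin_convex theta _ _ _ hu hv; rewrite (ltW th0) (ltW th1) => /(_ isT).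
have -> : ((1 - theta) * (u / 2) + theta * (v / 2) = ((1 - theta) * u + theta * v) / 2)%R by ring.
move: (log_sin _) (log_sin _) (log_sin _) => A B C; lra.
Qed.

Lemma normc_cisB (a b : R) :
  Normc.normc (cis a - cis b)%R = (2 * `|sin ((a - b) / 2)|)%R.
Proof.
rewrite /Normc.normc /=.
have -> : ((cos a - cos b) ^+ 2 + (sin a - sin b) ^+ 2 = (2 * sin ((a - b) / 2)) ^+ 2)%R.
  have := cosB a b; rewrite [X in cos X = _](_ : _ = ((a - b) / 2) *+ 2)%R; last by field.
  rewrite cos_mulr2n cos2sin2 => E.
  have := cos2Dsin2 a; have := cos2Dsin2 b; lra.
by rewrite sqrtr_sqr normrM ger0_norm.
Qed.

Lemma lne_chord (a b : R) :
  lne (Normc.normc (cis a - cis b)%R)%:E = (ln 2)%:E - arc_energy (a - b).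
Proof.
rewrite normc_cisB /arc_energy oppeK.
have [->|s0] := eqVneq (sin ((a - b) / 2)) 0%R.
  by rewrite normr0 mulr0 /= lexx addeNy.
have p : (0 < `|sin ((a - b) / 2)|)%R by rewrite normr_gt0.
by rewrite !lne_EFin ?mulr_gt0// -EFinD lnM ?posrE.
Qed.

End LogSinConvex.

(** * The circle as a measurable space *)

Section CircleMeasurable.
Context {R : realType}.

Lemma continuous_set_val : continuous (fun z : circle R => (set_val z : (R[i] : numFieldType))).
Proof. exact: initial_continuous. Qed.

Lemma continuous_Re : continuous (fun z : (R[i] : numFieldType) => complex.Re z : R).
Proof.
move=> z; have FF : ProperFilter (nbhs z) by typeclasses eauto.
apply/(@cvgrPdist_lt _ _ _ _ FF) => e e0.
have : nbhs z [set w : (R[i] : numFieldType) | `|z - w| < e%:C].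
  by apply/nbhs_ballP; exists e%:C; rewrite /= ?ltcR.
apply: filterS => w /=; rewrite normc_def ltcR; apply: le_lt_trans.
rewrite -ReN -ReD -sqrtr_sqr ler_wsqrtr// lerDl sqr_ge0//.
Qed.

Lemma continuous_Im : continuous (fun z : (R[i] : numFieldType) => complex.Im z : R).
Proof.
move=> z; have FF : ProperFilter (nbhs z) by typeclasses eauto.
apply/(@cvgrPdist_lt _ _ _ _ FF) => e e0.
have : nbhs z [set w : (R[i] : numFieldType) | `|z - w| < e%:C].
  by apply/nbhs_ballP; exists e%:C; rewrite /= ?ltcR.
apply: filterS => w /=; rewrite normc_def ltcR; apply: le_lt_trans.
rewrite -ImN -ImD -sqrtr_sqr ler_wsqrtr// lerDr sqr_ge0//.
Qed.

Lemma continuous_cis : continuous (fun t : R => cis t : (R[i] : numFieldType)).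
Proof.
move=> t; apply/cvgrPdist_lt => e; rewrite ltcE /= => /andP[/eqP ei e0].
have c : (fun s => 2 * `|sin ((t - s) / 2)|) s @[s --> t] --> (0 : R).
  have -> : (0 : R) = 2 * `|sin ((t - t) / 2)| by rewrite subrr mul0r sin0 normr0 mulr0.
  apply: cvgM; first exact: cvg_cst.
  apply: cvg_norm.
  apply: (@continuous_comp _ _ _ (fun s : R => (t - s) / 2) sin); last exact: continuous_sin.
  by apply: cvgM; [apply: cvgB; [exact: cvg_cst|exact: cvg_id]|exact: cvg_cst].
move/cvgrPdist_lt : c => /(_ _ e0); apply: filterS => s.
rewrite sub0r normrN ger0_norm ?mulr_ge0// => h.
rewrite ltcE ei /=; have := normc_cisB t s; rewrite /Normc.normc /=.
by rewrite eqxx /= => ->.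
Qed.

Lemma continuous_circ : continuous (circ : R -> circle R).
Proof.
apply: continuous_comp_initial => /=.
rewrite (_ : _ \o _ = cis); first exact: continuous_cis.
by apply/funext => t /=; exact: val_circ.
Qed.

Lemma measurable_circ : measurable_fun setT (circ : R -> borel_circle R).
Proof.
apply: (@measurability _ _ _ (borel_circle R) setT circ (@open (circle R)) erefl).
move=> _ [U oU <-].
rewrite setTI; apply: measurable_realfun.open_measurable.
by move/continuousP : continuous_circ; apply.
Qed.

Lemma continuous_circle_measurable (f : circle R -> R) : continuous f ->
  measurable_fun setT (f : borel_circle R -> R).
Proof.
move=> /continuousP cf; apply: (measurability _ (RGenOpens.measurableE R)).
move=> _ [_ [a [b ->] <-]]; rewrite setTI; apply: sub_sigma_algebra.
exact/cf/interval_open.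
Qed.

Lemma measurable_circle_Re : measurable_fun setT
  (fun z : borel_circle R => complex.Re (set_val z) : R).
Proof.
apply: continuous_circle_measurable => z.
apply: (@continuous_comp _ _ _ (fun z : circle R => (set_val z : (R[i] : numFieldType)))).
  exact: continuous_set_val.
exact: continuous_Re.
Qed.

Lemma measurable_circle_Im : measurable_fun setT
  (fun z : borel_circle R => complex.Im (set_val z) : R).
Proof.
apply: continuous_circle_measurable => z.
apply: (@continuous_comp _ _ _ (fun z : circle R => (set_val z : (R[i] : numFieldType)))).
  exact: continuous_set_val.
exact: continuous_Im.
Qed.

Definition angle (z : circle R) : R :=
  let a := acos (complex.Re (set_val z)) in
  if 0 <= complex.Im (set_val z) then a else 2 * pi - a.

Lemma circle_sqr (z : circle R) :
  complex.Re (set_val z) ^+ 2 + complex.Im (set_val z) ^+ 2 = 1.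
Proof.
have := set_valP z; rewrite /unit_circle /= normc_def => /complexI/(congr1 (@GRing.exp R ^~ 2)).
by rewrite sqr_sqrtr ?addr_ge0 ?sqr_ge0// expr1n.
Qed.

Lemma circle_Re (z : circle R) : -1 <= complex.Re (set_val z) <= 1.
Proof.
rewrite -ler_norml -(@expr_le1 _ 2)// real_normK ?num_real//.
by rewrite -(circle_sqr z) lerDl sqr_ge0.
Qed.

Lemma measurable_angle : measurable_fun setT (angle : borel_circle R -> R).
Proof.
have ma : measurable_fun setT (fun z : borel_circle R => acos (complex.Re (set_val z)) : R).
  apply: (@measurable_comp _ _ _ (borel_circle R) R R `[-1, 1]%classic (@acos R) setT
    (fun z => complex.Re (set_val z))) => //.
  - by move=> _ [z _ <-] /=; rewrite in_itv/= circle_Re.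
  - by apply: subspace_continuous_measurable_fun => //; exact: within_continuous_acos.
  - exact: measurable_circle_Re.
apply: measurable_fun_ifT => //; last exact: measurable_funB.
apply: measurable_fun_ler => //; exact: measurable_circle_Im.
Qed.

Lemma angle_itv (z : circle R) : 0 <= angle z <= 2 * pi.
Proof.
have := circle_Re z => h.
have := acos_ge0 h; have := acos_lepi h; have := pi_ge0 R.
rewrite /angle; case: ifP => _; lra.
Qed.

Lemma circ_angle (z : circle R) : circ (angle z) = z.
Proof.
apply: val_inj; rewrite -!set_valE val_circ.
have h := circle_Re z; have sq := circle_sqr z.
have cosa : cos (acos (complex.Re (set_val z))) = complex.Re (set_val z).
  by rewrite acosK// in_itv.
have sina := sin_acos h.
have sq' : 1 - complex.Re (set_val z) ^+ 2 = complex.Im (set_val z) ^+ 2.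
  by rewrite -sq addrAC subrr add0r.
rewrite sq' sqrtr_sqr in sina.
rewrite /angle; case: ifPn => im; apply: complex_ext => /=.
- exact: cosa.
- by rewrite sina ger0_norm.
- by rewrite (_ : 2 * pi - _ = - acos (complex.Re (set_val z)) + pi *+ 2) ?cosD2pi ?cosN//; ring.
- rewrite (_ : 2 * pi - _ = - acos (complex.Re (set_val z)) + pi *+ 2); last by ring.
  by rewrite sinD2pi sinN sina ltr0_norm ?opprK// ltNge.
Qed.

End CircleMeasurable.

(** * The uniform law on [0, 1] *)

Section UniformCdf.
Context {R : realType}.
Local Open Scope ereal_scope.

Lemma probability_cdf_unique (P Q : probability (measurableTypeR R) R) :
  (forall x : R, P `]-oo, x]%classic = Q `]-oo, x]%classic) ->
  forall A, measurable A -> P A = Q A.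
Proof.
move=> PQ A mA.
apply: (@measure_unique _ R (measurableTypeR R) (@RGenOInfty.G R)
  (fun n => `](- n%:R)%R, +oo[%classic) _ _ _ _ P Q) => //.
- exact: RGenOInfty.measurableE.
- move=> _ _ [x ->] [y ->]; exists (Num.max x y).
  by rewrite predeqE => z; split => [[]|] /=; rewrite !in_itv/= !andbT ?gt_max;
    [move=> -> ->|move=> /andP[]].
- by move=> i; eexists.
- rewrite -subTset => x _; exists (Num.truncn `|x|).+1 => //=.
  rewrite in_itv/= andbT ltrNl; apply: le_lt_trans (truncnS_gt _).
  by rewrite -normrN ler_norm.
- move=> _ [x ->].
  have E (S : probability (measurableTypeR R) R) :
      S `]x, +oo[%classic = 1 - S `]-oo, x]%classic.
    by rewrite -setCitvl; exact: probability_setC.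
  exact: etrans (E P) (etrans (congr1 (fun a => 1 - a) (PQ x)) (esym (E Q))).
- by move=> k; rewrite (le_lt_trans (probability_le1 _ _)) ?ltry.
Qed.

Definition unif : probability (measurableTypeR R) R := uniform_prob (@ltr01 R).

Lemma unifE (A : set R) : measurable A ->
  unif A = @lebesgue_measure R (A `&` `[0%R, 1%R]).
Proof.
move=> mA; rewrite /unif/= /uniform_prob integral_uniform_pdf.
rewrite (eq_integral (cst 1)); last first.
  by move=> x; rewrite inE/= in_itv/= => -[_ x01]; rewrite /uniform_pdf x01 subr0 invr1.
rewrite integral_cst ?mul1e//; exact: measurableI.
Qed.

(** Functions of interest on [0, 1] are precomposed with this retraction, so
that monotonicity and oscillation bounds hold on the whole line and no
restriction to [0, 1] has to be carried along. It is also the distribution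
function of the uniform law. *)
Definition clamp (t : R) : R := Num.max 0%R (Num.min t 1%R).

Lemma clamp_itv t : (0 <= clamp t <= 1)%R.
Proof. by rewrite /clamp le_max lexx/= ge_max ler01/= ge_min lexx orbT. Qed.

Lemma clamp_id t : (0 <= t <= 1)%R -> clamp t = t.
Proof. by move=> /andP[t0 t1]; rewrite /clamp min_l// max_r. Qed.

Lemma clamp_le s t : (s <= t)%R -> (clamp s <= clamp t)%R.
Proof.
move=> st; rewrite /clamp; case: (ltrP s 1%R) => ?; case: (ltrP t 1%R) => ?.
all: case: (ltrP 0%R s) => ?; case: (ltrP 0%R t) => ?; rewrite ?(max_r (@ler01 R)); lra.
Qed.

Lemma unif_below (x : R) (A : set R) : measurable A -> (0 <= x <= 1)%R ->
  (A `&` `[0%R, 1%R] = `[0%R, x]%classic) -> unif A = x%:E.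
Proof.
move=> mA /andP[x0 x1] E; rewrite unifE// E lebesgue_measure_itv/= lte_fin.
by move: x0; rewrite le_eqVlt => /predU1P[<-|->]; rewrite ?ltxx// oppr0 adde0.
Qed.

Lemma unif01 : unif `[0%R, 1%R]%classic = 1.
Proof. by apply: unif_below; rewrite ?ler01 ?lexx ?setIid. Qed.

Lemma unif_itv (b1 b2 : bool) (x y : R) : (0 <= x)%R -> (x <= y)%R -> (y <= 1)%R ->
  unif [set` Interval (BSide b1 x) (BSide b2 y)] = (y - x)%:E.
Proof.
move=> x0 xy y1; rewrite unifE// setIidl.
  rewrite lebesgue_measure_itv/= lte_fin.
  by move: xy; rewrite le_eqVlt => /predU1P[<-|->//]; rewrite ltxx subrr.
by case: b1; case: b2 => z /=; rewrite !in_itv/= => /andP[a b]; apply/andP; split; lra.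
Qed.

Lemma unif_cdf (x : R) : unif `]-oo, x]%classic = (clamp x)%:E.
Proof.
rewrite /clamp; case: (lerP x 1) => x1.
  case: (lerP 0%R x) => x0.
    apply: unif_below => //; first by rewrite x0.
    rewrite predeqE => t; split => /=; rewrite !in_itv/=; first by case=> -> /andP[->].
    by move=> /andP[t0 tx]; rewrite t0 tx (le_trans tx x1).
  rewrite unifE// (_ : _ `&` _ = set0) ?measure0//.
  by rewrite -subset0 => t [] /=; rewrite !in_itv/= => a /andP[b _]; have := lt_le_trans x0 (le_trans b a); rewrite ltxx.
rewrite max_r ?ler01//; apply: unif_below => //; rewrite ?ler01 ?lexx//.
rewrite predeqE => t; split => /=; rewrite !in_itv/=; first by case=> _ /andP[-> ->].
by move=> /andP[t0 t1]; rewrite t0 t1 (le_trans t1 (ltW x1)).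
Qed.

End UniformCdf.

(** * Quantile functions *)

Section Quantile.
Context {R : realType}.
Variables (nu : probability (measurableTypeR R) R) (c : R).
Hypothesis c_ge0 : 0 <= c.
Hypothesis nu_lt0 : forall x : R, x < 0 -> nu `]-oo, x]%classic = 0%E.
Hypothesis nu_c : nu `]-oo, c]%classic = 1%E.

Definition cumul (x : R) : R := fine (nu `]-oo, x]%classic).

Lemma cumulE x : (cumul x)%:E = nu `]-oo, x]%classic.
Proof. by rewrite fineK// fin_num_measure. Qed.

Lemma cumul_le x y : x <= y -> cumul x <= cumul y.
Proof.
move=> xy; rewrite -lee_fin !cumulE; apply: le_measure; rewrite ?inE//.
by move=> z /=; rewrite !in_itv/= => /le_trans; exact.
Qed.

Lemma cumul_itv x : 0 <= cumul x <= 1.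
Proof. by rewrite -!lee_fin cumulE measure_ge0 probability_le1. Qed.

Let idT : measurableTypeR R -> R := idfun.
#[local] HB.instance Definition _ :=
  @isMeasurableFun.Build _ _ _ _ idT (@measurable_id _ _ setT).

(** Right continuity of the distribution function. *)
Lemma cumul_right (t x : R) : (forall y, x < y -> t <= cumul y) -> t <= cumul x.
Proof.
move=> H; rewrite -lee_fin cumulE.
apply: (cvge_to_ge (@cdf_right_continuous _ _ R nu (idT : {RV nu >-> R}) x)) => //.
near=> y; rewrite /cdf /distribution /pushforward preimage_id -cumulE lee_fin.
by apply: H; near: y; exact: nbhs_right_gt.
Unshelve. all: by end_near. Qed.

Let S t := [set x | 0 <= x <= c /\ clamp t <= cumul x].

Definition quantile (t : R) : R := inf (S t).

Let Sc t : S t c.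
Proof.
split; first by rewrite lexx c_ge0.
by rewrite /cumul nu_c /=; case/andP: (clamp_itv t).
Qed.

Let S_lb t : has_lbound (S t).
Proof. by exists 0 => x [/andP[]]. Qed.

Lemma quantile_itv t : 0 <= quantile t <= c.
Proof.
apply/andP; split; last by apply: ge_inf; [exact: S_lb|exact: Sc].
by apply: lb_le_inf; [exists c; exact: Sc|move=> x [/andP[]]].
Qed.

(** The Galois connection between quantiles and the distribution function;
the infimum defining the quantile is attained by right continuity. *)
Lemma quantile_le t x : 0 <= x <= c -> (quantile t <= x) = (clamp t <= cumul x).
Proof.
move=> xc; apply/idP/idP => [qx|tx]; last by apply: ge_inf; [exact: S_lb|].
apply: cumul_right => y xy.
have [z [_ tz] zy] : exists2 z, S t z & z < y.
  have qy : 0 < y - quantile t by rewrite subr_gt0 (le_lt_trans qx).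
  have [|z Sz zy] := inf_adherent qy (E := S t).
    by split; [exists c; exact: Sc|exact: S_lb].
  by exists z => //; rewrite addrC subrK in zy.
exact: le_trans tz (cumul_le (ltW zy)).
Qed.

Lemma quantile_mono : nondecreasing_fun quantile.
Proof.
move=> s t st; rewrite quantile_le; last exact: quantile_itv.
apply: le_trans (clamp_le st) _.
by rewrite -quantile_le ?quantile_itv.
Qed.

Lemma quantile_law (x : R) :
  unif (quantile @^-1` `]-oo, x]%classic) = nu `]-oo, x]%classic.
Proof.
have mq : measurable (quantile @^-1` `]-oo, x]%classic).
  rewrite -[X in measurable X]setTI.
  exact: (nondecreasing_measurable measurableT quantile_mono).
have [x0|x0] := ltrP x 0.
  rewrite nu_lt0// (_ : _ @^-1` _ = set0) ?measure0//.
  rewrite -subset0 => t /=; rewrite in_itv/= => qx.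
  have /andP[q0 _] := quantile_itv t.
  by have := lt_le_trans x0 (le_trans q0 qx); rewrite ltxx.
have [cx|xc] := leP c x.
  have -> : nu `]-oo, x]%classic = 1%E.
    apply/eqP; rewrite eq_le probability_le1//= -nu_c.
    apply: le_measure; rewrite ?inE//.
    by move=> z /=; rewrite !in_itv/= => /le_trans; exact.
  rewrite (_ : _ @^-1` _ = setT) ?probability_setT//.
  rewrite -subTset => t _ /=; rewrite in_itv/=.
  by have /andP[_] := quantile_itv t; move=> /le_trans; exact.
rewrite -cumulE; apply: unif_below; rewrite ?cumul_itv//.
have xc' : 0 <= x <= c by rewrite x0 ltW.
rewrite predeqE => t; split => /=; rewrite !in_itv/=.
  by rewrite quantile_le// => -[+ t01]; rewrite clamp_id// => ->; case/andP: t01 => ->.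
move=> /andP[t0 tx]; have t01 : 0 <= t <= 1.
  by rewrite t0 (le_trans tx)//; case/andP: (cumul_itv x).
by rewrite quantile_le// clamp_id.
Qed.

End Quantile.

(** * Rotations of [0, 1] *)

Section Lift.
Context {R : realType}.

Lemma unif_ext (A B : set R) : measurable A -> measurable B ->
  (forall t, 0 <= t <= 1 -> A t <-> B t) -> unif A = unif B.
Proof.
move=> mA mB AB; rewrite !unifE//; congr lebesgue_measure.
by rewrite predeqE => t; split => /= -[h t01]; split=> //; apply/AB.
Qed.

Lemma unif_integral_ext (f g : R -> \bar R) :
  measurable_fun setT f -> measurable_fun setT g ->
  (forall t, 0 <= t <= 1 -> f t = g t) ->
  (\int[unif]_t f t = \int[unif]_t g t)%E.
Proof.
move=> mf mg fg; apply: ae_eq_integral => //.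
exists (~` `[0, 1]%classic); split.
- exact: measurableC.
- have E := @probability_setC _ _ _ (@unif R) `[0%R, 1%R]%classic (measurable_itv _).
  apply: etrans E _.
  by rewrite unif01 subee.
- by move=> t /= nfg t01; apply: nfg => _; apply: fg; rewrite in_itv in t01.
Qed.

(** Translation by s modulo 1, on the fundamental domain [0, 1]. *)
Definition rot (s t : R) : R := if t < 1 - s then t + s else t + s - 1.

Lemma rot_cases s t :
  (t < 1 - s /\ rot s t = t + s) \/ (1 - s <= t /\ rot s t = t + s - 1).
Proof. by rewrite /rot; case: ltrP; [left|right]. Qed.

Lemma measurable_rot s : measurable_fun setT (rot s : measurableTypeR R -> measurableTypeR R).
Proof.
apply: measurable_fun_ifT.
- exact: measurable_fun_ltr.
- exact: measurable_funD.
- by apply: measurable_funB => //; exact: measurable_funD.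
Qed.

Lemma rot_itv s t : 0 <= s <= 1 -> 0 <= t <= 1 -> 0 <= rot s t <= 1.
Proof.
by move=> /andP[s0 s1] /andP[t0 t1]; rewrite /rot; case: ltrP => h; apply/andP; split; lra.
Qed.

(** It suffices to compare distribution functions; the preimage of [0, x] is
one interval or the union of two according to whether x < s. *)
Lemma unif_rot (s : R) : 0 <= s <= 1 -> forall A, measurable A ->
  unif (rot s @^-1` A) = unif A.
Proof.
move=> s01.
pose rotm : {mfun measurableTypeR R >-> measurableTypeR R} :=
  HB.pack (rot s) (isMeasurableFun.Build _ _ (measurableTypeR R) (measurableTypeR R) (rot s)
      (measurable_rot s)).
move=> A mA.
apply: (@probability_cdf_unique _ (distribution unif rotm) unif) => // x.
rewrite unif_cdf; have /andP[s0 s1] := s01.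
have mrx (B : set R) : measurable B -> measurable (rot s @^-1` B).
  by move=> mB; rewrite -[X in measurable X]setTI; exact: measurable_rot.
rewrite /distribution /pushforward /=.
have [x0|x0] := ltrP x 0.
  have -> : clamp x = 0 by rewrite /clamp max_l// ge_min (ltW x0).
  transitivity (@unif R set0); last exact: measure0.
  apply: unif_ext => //; first exact: mrx.
  move=> t t01; split => //=; rewrite in_itv/= => rx.
  by have /andP[r0 _] := rot_itv s01 t01; have := lt_le_trans x0 (le_trans r0 rx); rewrite ltxx.
have [x1|x1] := lerP 1 x.
  have -> : clamp x = 1 by rewrite /clamp min_r// max_r.
  transitivity (@unif R `[0%R, 1%R]%classic); last exact: unif01.
  apply: unif_ext => //; first exact: mrx.
  move=> t t01; rewrite /= !in_itv/= t01; split => // _.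
  by have /andP[_ r1] := rot_itv s01 t01; exact: le_trans x1.
rewrite clamp_id ?x0 ?(ltW x1)//.
have [xs|sx] := ltrP x s.
  transitivity (@unif R `[1 - s, x + (1 - s)]%classic); last first.
    by rewrite (@unif_itv _ true false); [congr EFin|..]; lra.
  apply: unif_ext; [exact: mrx|by []|].
  move=> t /andP[t0 t1]; rewrite /= !in_itv/=.
  have [h|h] := rot_cases s t; rewrite h.2; split.
  - by move=> h'; have := h.1; exfalso; lra.
  - by move=> /andP[h' _]; have := h.1; exfalso; lra.
  - by move=> h'; have := h.1; move=> h1; apply/andP; split; lra.
  - by move=> /andP[_ h']; lra.
transitivity (@unif R (`[0, x - s]%classic `|` `[1 - s, 1]%classic)).
  apply: unif_ext; [exact: mrx|exact: measurableU|].
  move=> t /andP[t0 t1]; rewrite /= !in_itv/=.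
  have [h|h] := rot_cases s t; rewrite h.2; split; have h1 := h.1.
  + by move=> h'; left; apply/andP; split; lra.
  + by case=> /andP[h' h'']; lra.
  + by move=> _; right; apply/andP; split; lra.
  + by move=> _; lra.
transitivity (unif `[0%R, (x - s)%R]%classic + unif `[(1 - s)%R, 1%R]%classic)%E.
  apply: measureU => //; rewrite -subset0 => t [] /=; rewrite !in_itv/=.
  by move=> /andP[_ a] /andP[b _]; lra.
by rewrite !(@unif_itv _ true false) -?EFinD; [congr EFin|..]; lra.
Qed.

Lemma unif_integral_rot (s : R) (f : R -> R) : 0 <= s <= 1 ->
  measurable_fun setT f -> (forall t, 0 <= f t) ->
  (\int[unif]_t (f (rot s t))%:E = \int[unif]_t (f t)%:E)%E.
Proof.
move=> s01 mf f0.
pose rotm : {mfun measurableTypeR R >-> measurableTypeR R} :=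
  HB.pack (rot s) (isMeasurableFun.Build _ _ (measurableTypeR R) (measurableTypeR R) (rot s)
      (measurable_rot s)).
transitivity (\int[distribution unif rotm]_t (f t)%:E)%E.
  rewrite ge0_integral_pushforward ?preimage_setT//.
  - by apply/measurable_EFinP.
  - by move=> t _; rewrite lee_fin.
apply: eq_measure_integral => A mA _; exact: unif_rot.
Qed.

End Lift.

(** * Centered lifts of measures on the circle *)

Section CircleLift.
Context {R : realType}.

Lemma circB2pi (t : R) : circ (t - 2 * pi) = circ t.
Proof.
rewrite /circ; congr insubd; apply: complex_ext => /=.
  by rewrite -[in RHS](subrK (2 * pi) t) mulr_natl cosD2pi.
by rewrite -[in RHS](subrK (2 * pi) t) mulr_natl sinD2pi.
Qed.

(** Start from the quantile function q of the law of the angle in [0, 2 * pi].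
Rotating the parameter by s and subtracting 2 * pi on the part that has passed
the origin keeps the law on the circle, the monotonicity and the oscillation
bound, and lowers the mean of q by 2 * pi * (1 - s). Hence the mean vanishes
for s = 1 - (mean of q) / (2 * pi). Mean zero is the continuous counterpart of
determinant 1. *)
Lemma circle_lift (mu : circle_prob R) : exists X : R -> R,
  [/\ nondecreasing_fun X,
      forall s t, X t <= X s + 2 * pi,
      (\int[unif]_t (X t)%:E = 0)%E &
      forall A : set (borel_circle R), measurable A ->
        mu A = unif ((circ \o X) @^-1` A)].
Proof.
pose c : R := 2 * pi.
have c0 : 0 < c by rewrite mulr_gt0// pi_gt0.
pose angm : {mfun borel_circle R >-> measurableTypeR R} :=
  HB.pack (angle : borel_circle R -> R) (@isMeasurableFun.Build _ _ (borel_circle R)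
    (measurableTypeR R) angle measurable_angle).
pose nu : probability (measurableTypeR R) R := distribution mu angm.
have nu_lt0 x : x < 0 -> nu `]-oo, x]%classic = 0%E.
  move=> x0; rewrite /nu /= /distribution /pushforward (_ : _ @^-1` _ = set0) ?measure0//.
  rewrite -subset0 => z /=; rewrite in_itv/= => zx.
  by have /andP[z0 _] := angle_itv z; have := lt_le_trans x0 (le_trans z0 zx); rewrite ltxx.
have nu_c : nu `]-oo, c]%classic = 1%E.
  rewrite /nu /= /distribution /pushforward (_ : _ @^-1` _ = setT) ?probability_setT//.
  by rewrite -subTset => z _ /=; rewrite in_itv/=; case/andP: (angle_itv z).
pose q := quantile nu c.
have q_itv t : 0 <= q t <= c by exact: (quantile_itv (ltW c0) nu_c).
have q_mono : nondecreasing_fun q by exact: (quantile_mono (ltW c0) nu_c).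
have mq : measurable_fun setT q by exact: nondecreasing_measurable.
have q_law A : measurable A -> unif (q @^-1` A) = nu A.
  move=> mA.
  pose qm : {mfun measurableTypeR R >-> measurableTypeR R} :=
    HB.pack q (@isMeasurableFun.Build _ _ (measurableTypeR R) (measurableTypeR R) q mq).
  apply: (@probability_cdf_unique _ (distribution unif qm) nu) => // x.
  exact: (quantile_law (ltW c0) nu_lt0 nu_c).
pose I := (\int[unif]_t (q t)%:E)%E.
have I0 : (0 <= I)%E by apply: integral_ge0 => t _; rewrite lee_fin; case/andP: (q_itv t).
have Ic : (I <= c%:E)%E.
  apply: (@le_trans _ _ (\int[unif]_(t in [set: R]) (c%:E))%E).
    apply: ge0_le_integral => //.
    - by move=> t _; rewrite lee_fin; case/andP: (q_itv t).
    - exact/measurable_EFinP.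
    - by move=> t _; rewrite lee_fin; case/andP: (q_itv t).
  by rewrite integral_cst//= probability_setT mule1.
have Ifin : I \is a fin_num by rewrite ge0_fin_numE// (le_lt_trans Ic) ?ltry.
pose m0 := fine I.
have m0E : I = m0%:E by rewrite fineK.
have /andP[m00 m0c] : 0 <= m0 <= c by rewrite -!lee_fin -m0E I0 Ic.
pose s := 1 - m0 / c.
have s01 : 0 <= s <= 1.
  by rewrite /s subr_ge0 ler_pdivrMr// mul1r m0c lerBlDr lerDl divr_ge0// ltW.
pose b t : R := \1_(`]-oo, (1 - s)[%classic) t.
pose Xc t := q (rot s t) - c * b t.
pose X t := Xc (clamp t).
have cl (t : R) : 0 <= clamp t <= 1 by exact: clamp_itv.
have XcE t : (t < 1 - s /\ Xc t = q (t + s) - c) \/ (1 - s <= t /\ Xc t = q (t + s - 1)).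
  rewrite /Xc /rot /b indicE; case: (ltrP t (1 - s)) => h; [left|right]; split => //.
    by rewrite mem_set ?mulr1//= in_itv/=.
  by rewrite memNset ?mulr0 ?subr0//= in_itv/=; apply/negP; rewrite -leNgt.
have Xc_mono u v : 0 <= u <= 1 -> 0 <= v <= 1 -> u <= v -> Xc u <= Xc v.
  move=> u01 v01 uv.
  case: (XcE u) => -[hu ->]; case: (XcE v) => -[hv ->].
  - by rewrite lerD2r; apply: q_mono; rewrite lerD2r.
  - have /andP[_ a] := q_itv (u + s); have /andP[a' _] := q_itv (v + s - 1); lra.
  - by exfalso; lra.
  - by apply: q_mono; rewrite !lerD2r.
have Xc_window u v : 0 <= u <= 1 -> 0 <= v <= 1 -> Xc v <= Xc u + c.
  move=> /andP[u0 u1] /andP[v0 v1].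
  have /andP[qu0 qu1] := q_itv (u + s); have /andP[qv0 qv1] := q_itv (v + s).
  have /andP[ru0 ru1] := q_itv (u + s - 1); have /andP[rv0 rv1] := q_itv (v + s - 1).
  case: (XcE u) => -[hu ->]; case: (XcE v) => -[hv ->]; try lra.
  by rewrite subrK; apply: q_mono; have /andP[? ?] := s01; lra.
have X_mono : nondecreasing_fun X.
  by move=> u v uv; exact: (Xc_mono _ _ (cl u) (cl v) (clamp_le uv)).
have mX : measurable_fun setT X by exact: nondecreasing_measurable.
have mqr : measurable_fun setT (fun t => q (rot s t)).
  exact: (measurableT_comp mq (@measurable_rot R s)).
have mb : measurable_fun setT (fun t => c * b t).
  by apply: measurable_funM => //; exact: measurable_indic.
exists X; split => //.
- by move=> u v; exact: (Xc_window _ _ (cl u) (cl v)).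
- rewrite (@unif_integral_ext _ (fun t => (X t)%:E) (fun t => ((q (rot s t))%:E - (c * b t)%:E)%E)).
  + have int1 : (@unif R).-integrable setT (fun t => (q (rot s t))%:E).
      apply: (@le_integrable _ _ _ _ _ _ _ (fun=> c%:E)) => //.
      * exact/measurable_EFinP.
      * move=> t _ /=; rewrite lee_fin !ger0_norm ?(ltW c0)//; by case/andP: (q_itv (rot s t)).
      * exact: finite_measure_integrable_cst.
    have int2 : (@unif R).-integrable setT (fun t => (c * b t)%:E).
      apply: (@le_integrable _ _ _ _ _ _ _ (fun=> c%:E)) => //.
      * exact/measurable_EFinP.
      * move=> t _ /=; rewrite lee_fin /b indicE.
        by case: (_ \in _); rewrite ?mulr1// mulr0 normr0.
      * exact: finite_measure_integrable_cst.
    rewrite integralB// unif_integral_rot//; last by move=> t; case/andP: (q_itv t).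
    rewrite -/I m0E.
    have -> : (\int[unif]_t (c * b t)%:E = m0%:E)%E; last by rewrite subee.
    under eq_integral do rewrite EFinM.
    rewrite integralZl//; last first.
      apply: (@le_integrable _ _ _ _ _ _ _ (fun=> 1%:E)) => //.
      * by apply/measurable_EFinP; exact: measurable_indic.
      * move=> t _ /=; rewrite lee_fin /b indicE.
        by case: (_ \in _); rewrite /= ?normr1 ?normr0 ?ler01 ?lexx.
      * exact: finite_measure_integrable_cst.
    rewrite integral_indic//= setIT.
    rewrite (@unif_ext _ _ `[0, (1 - s)[%classic)//; last first.
      by move=> t /andP[t0 _]; rewrite /= !in_itv/= t0.
    have /andP[s0 s1] := s01.
    rewrite (@unif_itv _ true true); [|lra..].
    rewrite subr0 -EFinM.
    by congr EFin; rewrite /s subKr mulrC divfK// gt_eqF.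
  + exact/measurable_EFinP.
  + by apply: emeasurable_funB; exact/measurable_EFinP.
  + by move=> t t01; rewrite /X clamp_id.
- move=> A mA.
  have mcA : measurable (circ @^-1` A : set R).
    by rewrite -[X in measurable X]setTI; exact: measurable_circ.
  transitivity (nu (circ @^-1` A)).
    by rewrite /nu /= /distribution /pushforward; congr (mu _);
       apply/seteqP; split => z /=; rewrite circ_angle.
  rewrite -q_law// -(unif_rot s01); last first.
    by rewrite -[X in measurable X]setTI; exact: mq.
  apply: unif_ext.
  + by rewrite -[X in measurable X]setTI; exact: mqr.
  + rewrite -[X in measurable X]setTI.
    exact: (measurableT_comp (@measurable_circ R) mX).
  + move=> t t01 /=; rewrite /X clamp_id//.
    suff -> : circ (Xc t) = circ (q (rot s t)) by [].
    rewrite /Xc /b indicE; case: (_ \in _); rewrite ?mulr0 ?subr0// mulr1.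
    exact: circB2pi.
Qed.

End CircleLift.

(** * Logarithmic energy of a lifted measure *)

Section EnergyOfLift.
Context {R : realType}.
Local Open Scope ereal_scope.

(** The integral of k may be infinite, in which case additivity is not
available and the negative part has to be bounded from below. *)
Lemma integral_cstB d (T : measurableType d) (P : {measure set T -> \bar R})
  (c : R) (k : T -> \bar R) : P setT = 1 -> measurable_fun setT k ->
  (forall x, 0 <= k x) ->
  \int[P]_x (c%:E - k x) = c%:E - \int[P]_x k x.
Proof.
move=> P1 mk k0.
have cst_int (a : R) : \int[P]_(x in [set: T]) a%:E = a%:E.
  by apply: (etrans (integral_cst P measurableT a%:E)); rewrite P1 mule1.
have ci : P.-integrable setT (fun=> c%:E).
  by apply/integrableP; split => //=; rewrite cst_int ltry.
have I0 : 0 <= \int[P]_x k x by exact: integral_ge0.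
have [Ifin|Iinf] := ltP (\int[P]_x k x) +oo.
  have ki : P.-integrable setT k.
    apply/integrableP; split => //.
    by under eq_integral do rewrite gee0_abs//.
  by rewrite integralB// cst_int.
have IE : \int[P]_x k x = +oo by apply/eqP; rewrite eq_le leey.
rewrite IE; pose h x := c%:E - k x; rewrite -/(h _).
have mh : measurable_fun setT h by exact: emeasurable_funB.
rewrite [LHS]integralE.
have pos : \int[P]_x h^\+ x <= `|c|%:E.
  rewrite -[leRHS]cst_int; apply: ge0_le_integral => //.
  - exact: measurable_funepos.
  - move=> x _; rewrite funeposE ge_max lee_fin normr_ge0 andbT /h.
    apply: (@le_trans _ _ c%:E); last by rewrite lee_fin ler_norm.
    have := k0 x; case: (k x) => [r| |] //=; rewrite ?leNye//.
    by rewrite -EFinB !lee_fin gerBl.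
have neg : \int[P]_x h^\- x = +oo.
  apply/eqP; rewrite eq_le leey/=.
  have : \int[P]_x k x <= \int[P]_x (h^\- x + `|c|%:E).
    apply: ge0_le_integral => //.
    - by apply: emeasurable_funD => //; exact: measurable_funeneg.
    - move=> x _; rewrite funenegE /h.
      have := k0 x; case: (k x) => [r| |] //= _.
        rewrite -?EFinB -?EFinN -EFin_max -EFinD lee_fin.
        have := ler_norm c; rewrite -lerBlDr le_max => ?; apply/orP; left; lra.
  rewrite IE ge0_integralD//; last exact: measurable_funeneg.
  rewrite cst_int leye_eq => /eqP.
  by case: (\int[P]_x h^\- x) => //= r; rewrite -EFinD.
by rewrite neg addeNy.
Qed.

Lemma measurable_lne_EFin : measurable_fun setT (fun r : R => lne r%:E).
Proof.
apply: measurable_fun_ifT => //; first exact: measurable_fun_ler.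
by apply/measurable_EFinP.
Qed.

(** Subtracting the logarithm from its maximum ln 2 makes the kernel
nonnegative, so that Tonelli's theorem applies without integrability. *)
Definition log_kernel (p : borel_circle R * borel_circle R) : \bar R :=
  (ln 2)%:E - lne (Normc.normc (set_val p.1 - set_val p.2)%R)%:E.

Lemma measurable_log_kernel : measurable_fun setT log_kernel.
Proof.
apply: emeasurable_funB => //.
apply: (measurableT_comp measurable_lne_EFin).
have mR (i : bool) : measurable_fun setT (fun p : borel_circle R * borel_circle R =>
    complex.Re (set_val (if i then p.1 else p.2)) : R).
  by case: i; apply: (measurableT_comp (@measurable_circle_Re R)).
have mI (i : bool) : measurable_fun setT (fun p : borel_circle R * borel_circle R =>
    complex.Im (set_val (if i then p.1 else p.2)) : R).
  by case: i; apply: (measurableT_comp (@measurable_circle_Im R)).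
rewrite (_ : (fun _ => _) = Num.sqrt \o (fun p : borel_circle R * borel_circle R =>
  (complex.Re (set_val p.1) - complex.Re (set_val p.2)) ^+ 2 +
  (complex.Im (set_val p.1) - complex.Im (set_val p.2)) ^+ 2)%R).
  apply: measurableT_comp; first by apply: continuous_measurable_fun; exact: sqrt_continuous.
  apply: measurable_funD; apply: measurable_funX; apply: measurable_funB.
  - exact: (mR true).
  - exact: (mR false).
  - exact: (mI true).
  - exact: (mI false).
apply/funext => p /=; rewrite /Normc.normc.
by case: (set_val p.1) => a b; case: (set_val p.2) => a' b' /=.
Qed.

Lemma log_kernel_circ (a b : R) : log_kernel (circ a, circ b) = arc_energy (a - b).
Proof.
have E : lne (Normc.normc (set_val (circ a) - set_val (circ b))%R)%:E =
    (ln 2)%:E - arc_energy (a - b) by rewrite !val_circ; exact: lne_chord.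
rewrite /log_kernel E.
have := arc_energy_ge0 (a - b).
case: (arc_energy (a - b)) => [r| |] //= _.
by rewrite -!EFinD; congr EFin; ring.
Qed.

Lemma log_kernel_ge0 p : 0 <= log_kernel p.
Proof.
case: p => z w; rewrite -(circ_angle z) -(circ_angle w) log_kernel_circ.
exact: arc_energy_ge0.
Qed.

Definition law_of (X : R -> R) (mu : circle_prob R) :=
  forall A : set (borel_circle R), measurable A -> mu A = unif ((circ \o X) @^-1` A).

Lemma ge0_integral_law (X : R -> R) (mu : circle_prob R) (F : borel_circle R -> \bar R) :
  measurable_fun setT X -> law_of X mu ->
  measurable_fun setT F -> (forall z, 0 <= F z) ->
  \int[mu]_z F z = \int[unif]_t F (circ (X t)).
Proof.
move=> mX XE mF F0.
have mcX : measurable_fun setT (circ \o X : measurableTypeR R -> borel_circle R).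
  exact: (measurableT_comp (@measurable_circ R) mX).
transitivity (\int[pushforward (@unif R) (circ \o X : measurableTypeR R -> borel_circle R)]_z F z).
  by apply: eq_measure_integral => A mA _; exact: XE.
by rewrite (ge0_integral_pushforward mcX)// preimage_setT.
Qed.

Definition lift_energy (X : R -> R) : \bar R :=
  \int[unif]_s \int[unif]_t arc_energy (X s - X t).

Lemma free_entropy_law (X : R -> R) (mu : circle_prob R) :
  measurable_fun setT X -> law_of X mu ->
  free_entropy mu = (ln 2)%:E - lift_energy X.
Proof.
move=> mX XE.
have mm1 : (mu \x mu) setT = 1.
  rewrite -setXTT; transitivity (mu setT * mu setT); first exact: product_measure1E.
  have -> : mu setT = 1 by exact: probability_setT.
  by rewrite mule1.
transitivity (\int[mu \x mu]_p ((ln 2)%:E - log_kernel p)).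
  apply: eq_integral => p _; rewrite /log_kernel.
  by case: (lne _) => [r| |] //=; rewrite -!EFinD; congr EFin; ring.
rewrite integral_cstB//; last 2 first.
- exact: measurable_log_kernel.
- exact: log_kernel_ge0.
congr (_ - _).
rewrite (fubini_tonelli1 _ measurable_log_kernel)//; last exact: log_kernel_ge0.
have mF := @measurable_fun_fubini_tonelli_F _ _ _ _ R mu _ measurable_log_kernel log_kernel_ge0.
rewrite (ge0_integral_law mX XE)//; last first.
  by move=> z; apply: integral_ge0 => w _; exact: log_kernel_ge0.
apply: eq_integral => s _; rewrite /fubini_F (ge0_integral_law mX XE)//.
- by apply: eq_integral => t _; exact: log_kernel_circ.
- exact: (measurableT_comp measurable_log_kernel (pair1_measurable _)).
- by move=> w; exact: log_kernel_ge0.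
Qed.

End EnergyOfLift.

(** * Means over [0, 1] *)

Section UnifMean.
Context {R : realType}.
Implicit Types f g : R -> R.

Definition bounded_mfun f :=
  measurable_fun setT f /\ exists M, forall t, `|f t| <= M.

Lemma bounded_mfunD f g : bounded_mfun f -> bounded_mfun g ->
  bounded_mfun (fun t => f t + g t).
Proof.
move=> [mf [M fM]] [mg [L gL]]; split; first exact: measurable_funD.
by exists (M + L) => t; rewrite (le_trans (ler_normD _ _))// lerD.
Qed.

Lemma bounded_mfunM f g : bounded_mfun f -> bounded_mfun g ->
  bounded_mfun (fun t => f t * g t).
Proof.
move=> [mf [M fM]] [mg [L gL]]; split; first exact: measurable_funM.
by exists (M * L) => t; rewrite normrM ler_pM.
Qed.

Lemma bounded_mfun_cst (c : R) : bounded_mfun (fun=> c).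
Proof. by split; [exact: measurable_cst|exists `|c|]. Qed.

Lemma bounded_mfunZ (c : R) f : bounded_mfun f -> bounded_mfun (fun t => c * f t).
Proof. exact/bounded_mfunM/bounded_mfun_cst. Qed.

Lemma bounded_mfunB f g : bounded_mfun f -> bounded_mfun g ->
  bounded_mfun (fun t => f t - g t).
Proof.
move=> bf /(bounded_mfunZ (-1)) bg.
have := bounded_mfunD bf bg; congr bounded_mfun.
by apply/funext => t; rewrite mulN1r.
Qed.

Lemma bounded_mfun_integrable f : bounded_mfun f ->
  (@unif R).-integrable setT (EFin \o f).
Proof.
move=> [mf [M fM]].
apply: (@le_integrable _ _ _ _ _ _ _ (fun=> M%:E)) => //.
- exact/measurable_EFinP.
- by move=> t _ /=; rewrite lee_fin (le_trans (fM t))// ler_norm.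
- exact: finite_measure_integrable_cst.
Qed.

Definition umean f : R := \int[unif]_t f t.

Lemma umeanE f : bounded_mfun f -> (\int[unif]_t (f t)%:E = (umean f)%:E)%E.
Proof.
move=> /bounded_mfun_integrable bf; rewrite /umean /Rintegral fineK//.
exact: integrable_fin_num.
Qed.

Lemma umeanD f g : bounded_mfun f -> bounded_mfun g ->
  umean (fun t => f t + g t) = umean f + umean g.
Proof. by move=> bf bg; apply: RintegralD => //; exact: bounded_mfun_integrable. Qed.

Lemma umeanZ (c : R) f : bounded_mfun f -> umean (fun t => c * f t) = c * umean f.
Proof. by move=> bf; apply: RintegralZl => //; exact: bounded_mfun_integrable. Qed.

Lemma umeanB f g : bounded_mfun f -> bounded_mfun g ->
  umean (fun t => f t - g t) = umean f - umean g.
Proof. by move=> bf bg; apply: RintegralB => //; exact: bounded_mfun_integrable. Qed.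

Lemma umean_cst (c : R) : umean (fun=> c) = c.
Proof.
apply: EFin_inj; rewrite -umeanE; last exact: bounded_mfun_cst.
by rewrite integral_cst//= probability_setT mule1.
Qed.

Lemma umean_indic (A : set R) : measurable A -> (umean \1_A)%:E = unif A.
Proof.
move=> mA; rewrite -umeanE; last first.
  split; first exact: measurable_indic.
  by exists 1 => t; rewrite indicE; case: (_ \in _); rewrite ?normr1 ?normr0.
by rewrite integral_indic// setIT.
Qed.

Lemma umean_le f g : bounded_mfun f -> bounded_mfun g ->
  (forall t, 0 <= t < 1 -> f t <= g t) -> umean f <= umean g.
Proof.
move=> bf bg fg; rewrite -lee_fin -!umeanE//.
have m01 : measurable (~` (`[0%R, 1%R[%classic : set R)) by exact: measurableC.
have null : @unif R (~` `[0%R, 1%R[%classic) = 0%E.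
  have E := @probability_setC _ _ _ (@unif R) `[0%R, 1%R[%classic (measurable_itv _).
  transitivity (1 - @unif R `[0%R, 1%R[%classic)%E; first exact: E.
  by rewrite (@unif_itv _ true true)// subr0 subee.
rewrite (@negligible_integral _ _ _ unif setT _ _ m01 _ _ null)//; last exact: bounded_mfun_integrable.
rewrite [leRHS](@negligible_integral _ _ _ unif setT _ _ m01 _ _ null)//; last exact: bounded_mfun_integrable.
rewrite setDE setCK setTI; apply: le_integral => //.
- by apply: integrableS (bounded_mfun_integrable bf).
- by apply: integrableS (bounded_mfun_integrable bg).
- by move=> t /=; rewrite inE/= in_itv/= lee_fin; exact: fg.
Qed.

(** Lower Riemann sums. The step function with values m j is supported on
half-open cells, which partition [0, 1[; the uniform law does not see the
endpoint 1. *)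
Lemma umean_ge_step (n : nat) f (m : 'I_n.+1 -> R) : bounded_mfun f ->
  (forall (j : 'I_n.+1) t, j%:R / n.+1%:R <= t <= j.+1%:R / n.+1%:R -> m j <= f t) ->
  n.+1%:R^-1 * \sum_j m j <= umean f.
Proof.
move=> bf mf; set N : R := n.+1%:R.
have N0 : 0 < N by rewrite ltr0n.
pose I (j : nat) : set R := `[j%:R / N, j.+1%:R / N[%classic.
have mI (j : nat) : measurable (I j) by exact: measurable_itv.
have bI (j : nat) : bounded_mfun (\1_(I j)).
  split; first exact: (measurable_indic (mI j)).
  by exists 1 => t; rewrite indicE; case: (_ \in _); rewrite ?normr1 ?normr0.
pose G t := \sum_(j < n.+1) m j * \1_(I j) t.
have bsum (r : seq 'I_n.+1) : bounded_mfun (fun t => \sum_(j <- r) m j * \1_(I j) t) /\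
    umean (fun t => \sum_(j <- r) m j * \1_(I j) t) = N^-1 * \sum_(j <- r) m j.
  elim: r => [|j r [IH1 IH2]].
    rewrite big_nil mulr0; split; last first.
      by rewrite -[RHS](umean_cst 0); congr umean; apply/funext => t; rewrite big_nil.
    have := bounded_mfun_cst 0; congr bounded_mfun.
    by apply/funext => t; rewrite big_nil.
  have -> : (fun t => \sum_(i <- j :: r) m i * \1_(I i) t) =
      (fun t => m j * \1_(I j) t + \sum_(i <- r) m i * \1_(I i) t).
    by apply/funext => t; rewrite big_cons.
  have b1 := bounded_mfunZ (m j) (bI j).
  split; first exact: bounded_mfunD.
  rewrite umeanD// IH2 umeanZ// big_cons mulrDr; congr (_ + _).
  have -> : umean \1_(I j) = N^-1.
    apply: EFin_inj; rewrite umean_indic//.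
    rewrite (@unif_itv _ true true).
    - by congr EFin; rewrite -mulrBl -natrB// subSnn mul1r.
    - by rewrite divr_ge0// ltW.
    - by rewrite ler_pM2r ?invr_gt0// ler_nat.
    - by rewrite ler_pdivrMr// mul1r ler_nat.
  by rewrite mulrC.
have [bG EG] := bsum (index_enum _).
rewrite -EG; apply: umean_le => // t /andP[t0 t1].
have jn : (Num.truncn (N * t) < n.+1)%N.
  by rewrite truncn_lt_nat ?gtr_pMr// mulr_ge0// ltW.
(* t lies in the cell of index j0 and in no other. *)
pose j0 := Ordinal jn.
have /andP[j1 j2] : j0%:R <= N * t < j0.+1%:R.
  by rewrite truncn_itv// mulr_ge0// ltW.
have -> : \sum_(j < n.+1) m j * \1_(I j) t = m j0.
  rewrite (bigD1 j0)//= big1 => [|j jj0].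
    rewrite addr0 indicE mem_set ?mulr1// /I /= in_itv/=.
    by rewrite ler_pdivrMr// ltr_pdivlMr// [t * N]mulrC j1.
  rewrite indicE memNset ?mulr0// /I /= in_itv/= ler_pdivrMr// ltr_pdivlMr// [t * N]mulrC.
  move=> /andP[a b]; move/eqP: jj0; apply; apply/val_inj/eqP => /=.
  rewrite eqn_leq; apply/andP; split; rewrite -ltnS -(ltr_nat R).
    exact: le_lt_trans a j2.
  exact: le_lt_trans j1 b.
apply: mf; rewrite ler_pdivrMr// ler_pdivlMr// [t * N]mulrC j1/=.
exact: ltW.
Qed.

End UnifMean.

(** * Riemann sums along centered lifts *)

Section RiemannSums.
Context {R : realType}.

(** The functions X for which exp(i X) parametrizes a probability measure on the
circle monotonically and going around at most once. *)
Definition centered_lift (X : R -> R) :=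
  [/\ nondecreasing_fun X, forall s t, X t <= X s + 2 * pi & umean X = 0].

Lemma centered_lift_bounded X : centered_lift X -> bounded_mfun X.
Proof.
move=> [Xm Xw _]; split; first exact: nondecreasing_measurable.
exists (`|X 0| + 2 * pi) => t; have := Xw 0 t; have := Xw t 0.
have := ler_norm (X 0); have := ler_norm (- X 0); rewrite normrN.
by move=> h1 h2 h3 h4; rewrite ler_norml; apply/andP; split; lra.
Qed.

Section Grid.
Variables (n : nat) (X : R -> R).
Hypothesis cX : centered_lift X.
Let N : R := n.+1%:R.
Let pt (j : nat) : R := j%:R / N.
Let N0 : 0 < N. Proof. by rewrite ltr0n. Qed.

(** Minus the Riemann sum of X: adding it to the sample values makes their sum
vanish, so that they are the angles of a matrix of determinant 1. *)
Definition grid_shift : R := - (N^-1 * \sum_(j < n.+1) X (pt j)).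

(** The lower and upper Riemann sums of X enclose its mean, which is 0, and
differ by (X 1 - X 0) / N. *)
Lemma grid_shift_itv : 0 <= grid_shift <= 2 * pi / N.
Proof.
have bX := centered_lift_bounded cX; have [Xm Xw X0] := cX.
have low : N^-1 * \sum_(j < n.+1) X (pt j) <= 0.
  rewrite -[leRHS]X0; apply: umean_ge_step => // j t /andP[jt _]; exact: Xm.
have up : N^-1 * \sum_(j < n.+1) - X (pt j.+1) <= 0.
  have := umean_cst (0 : R); have E : umean (fun t => - 1 * X t) = 0.
    by rewrite umeanZ// X0 mulr0.
  move=> _; rewrite -[leRHS]E; apply: umean_ge_step; first exact: bounded_mfunZ.
  by move=> j t /andP[_ tj]; rewrite mulN1r lerN2; exact: Xm.
have tele : \sum_(j < n.+1) X (pt j.+1) = \sum_(j < n.+1) X (pt j) + (X (pt n.+1) - X (pt 0)).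
  have := telescope_sumr (fun j => X (pt j)) (leq0n n.+1).
  by rewrite big_mkord sumrB => <-; rewrite addrC subrK.
have w := Xw (pt 0) (pt n.+1).
rewrite /grid_shift oppr_ge0 low/= ler_pdivlMr// mulrC mulrN mulVKf ?gt_eqF//.
move: up; rewrite sumrN tele pmulr_rle0 ?invr_gt0// oppr_le0 => up; lra.
Qed.

Definition grid_point (j : 'I_n.+1) : R := X (pt j) + grid_shift.

Definition grid_step (j : 'I_n.+1) : R := X (pt j.+1) - X (pt j).

Lemma grid_point_sum : \sum_j grid_point j = 0.
Proof.
by rewrite big_split /= sumr_const card_ord /grid_shift -mulr_natl mulrN mulVKf ?subrr.
Qed.

Lemma grid_step_sum : N^-1 * \sum_j grid_step j <= 2 * pi / N.
Proof.
have [_ Xw _] := cX.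
have := telescope_sumr (fun j => X (pt j)) (leq0n n.+1).
rewrite big_mkord /grid_step => ->.
by rewrite mulrC ler_pM2r ?invr_gt0// lerBlDl.
Qed.

Lemma grid_point_dist (j : 'I_n.+1) t : pt j <= t <= pt j.+1 ->
  `|X t - grid_point j| <= grid_step j + grid_shift.
Proof.
have [Xm _ _] := cX; move=> /andP[jt tj].
have h1 := Xm _ _ jt; have h2 := Xm _ _ tj; have /andP[a0 _] := grid_shift_itv.
by rewrite /grid_point /grid_step ler_norml; apply/andP; split; lra.
Qed.

Lemma grid_point_mono (i j : 'I_n.+1) : (i <= j)%N -> grid_point i <= grid_point j.
Proof.
move=> ij; have [Xm _ _] := cX; rewrite lerD2r; apply: Xm.
by rewrite ler_pM2r ?invr_gt0// ler_nat.
Qed.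

Lemma grid_point_window (i j : 'I_n.+1) : grid_point j <= grid_point i + 2 * pi.
Proof. by have [_ Xw _] := cX; rewrite /grid_point addrAC lerD2r. Qed.

Lemma grid_point_norm (j : 'I_n.+1) M : (forall t, `|X t| <= M) ->
  `|grid_point j| <= M + 2 * pi.
Proof.
move=> XM; rewrite (le_trans (ler_normD _ _))// lerD//.
have /andP[a0 a1] := grid_shift_itv.
rewrite ger0_norm// (le_trans a1)// ler_pdivrMr// ler_peMr ?mulr_ge0 ?pi_ge0//.
by rewrite ler1n.
Qed.

End Grid.

(** Uniform continuity on bounded sets in an additive form: with the error eps
allowed, a modulus of continuity becomes linear. Errors of Riemann sums then
telescope along monotone functions. *)
Definition almost_lipschitz (Phi : R -> R -> R) := forall M eps, 0 < eps ->
  exists2 C, 0 <= C & forall a a' b b',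
    `|a| <= M -> `|a'| <= M -> `|b| <= M -> `|b'| <= M ->
    `|Phi a b - Phi a' b'| <= eps + C * (`|a - a'| + `|b - b'|).

Let sum_error n (P g1 g2 : 'I_n.+1 -> R) (e C a b : R) :
  \sum_j (P j - e - C * ((g1 j + a) + (g2 j + b))) =
  \sum_j P j - n.+1%:R * e -
    C * (\sum_j g1 j + \sum_j g2 j + n.+1%:R * (a + b)).
Proof.
rewrite !sumrB sumr_const card_ord -mulr_sumr !big_split /= !sumr_const !card_ord.
by rewrite !mulr_natl; ring.
Qed.

(** On each cell Phi differs from its value at the shifted sample points by at
most eps plus C times the increments of X and Y and the two shifts. The
increments sum to at most 2 * pi and the shifts are at most 2 * pi / n.+1, so
the total error is eps + C * (8 * pi) / n.+1. *)
Lemma riemann_nonneg (Phi : R -> R -> R) (X Y : R -> R) :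
  centered_lift X -> centered_lift Y -> almost_lipschitz Phi ->
  bounded_mfun (fun t => Phi (X t) (Y t)) ->
  (forall n (x y : 'I_n.+1 -> R), \sum_j x j = 0 -> \sum_j y j = 0 ->
    (forall i j, (y i - x i) - (y j - x j) <= 2 * pi) ->
    0 <= \sum_j Phi (x j) (y j)) ->
  0 <= umean (fun t => Phi (X t) (Y t)).
Proof.
move=> cX cY lip bPhi disc.
have [_ [MX XM]] := centered_lift_bounded cX.
have [_ [MY YM]] := centered_lift_bounded cY.
pose M : R := Num.max MX MY + 2 * pi.
have p0 := pi_ge0 R.
apply/ler_addgt0Pl => eta eta0.
have [|C C0 PhiC] := lip M (eta / 2); first by rewrite divr_gt0.
have [n nC] : exists n : nat, C * (8 * pi) / n.+1%:R <= eta / 2.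
  exists (Num.truncn (C * (8 * pi) / (eta / 2))).
  rewrite ler_pdivrMr ?ltr0n// [X in _ <= X]mulrC -ler_pdivrMr ?divr_gt0//.
  by apply: ltW; apply: truncnS_gt.
pose N : R := n.+1%:R; have N0 : 0 < N by rewrite ltr0n.
pose x := @grid_point n X; pose y := @grid_point n Y.
have /andP[ax0 ax1] := grid_shift_itv n cX.
have /andP[ay0 ay1] := grid_shift_itv n cY.
have window i j : (y i - x i) - (y j - x j) <= 2 * pi.
  have [ij|/ltnW ij] := leqP i j.
    have := grid_point_mono cY ij; have := grid_point_window cX i j.
    rewrite -/(x _) -/(x _) -/(y _) -/(y _) => *; lra.
  have := grid_point_mono cX ij; have := grid_point_window cY j i.
  rewrite -/(x _) -/(x _) -/(y _) -/(y _) => *; lra.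
have Phi0 := disc n x y (grid_point_sum n X) (grid_point_sum n Y) window.
pose m j := Phi (x j) (y j) - eta / 2 -
  C * ((grid_step X j + grid_shift n X) + (grid_step Y j + grid_shift n Y)).
have step : N^-1 * \sum_j m j <= umean (fun t => Phi (X t) (Y t)).
  apply: umean_ge_step => // j t jt.
  have dx := grid_point_dist cX jt; have dy := grid_point_dist cY jt.
  have XtM : `|X t| <= M by rewrite /M (le_trans (XM t))// ler_wpDr ?mulr_ge0// le_max lexx.
  have YtM : `|Y t| <= M by rewrite /M (le_trans (YM t))// ler_wpDr ?mulr_ge0// le_max lexx orbT.
  have xM : `|x j| <= M by apply: grid_point_norm => // s; rewrite (le_trans (XM s))// le_max lexx.
  have yM : `|y j| <= M by apply: grid_point_norm => // s; rewrite (le_trans (YM s))// le_max lexx orbT.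
  have := PhiC _ _ _ _ XtM xM YtM yM.
  rewrite ler_norml => /andP[+ _].
  have : C * (`|X t - x j| + `|Y t - y j|) <=
     C * ((grid_step X j + grid_shift n X) + (grid_step Y j + grid_shift n Y)).
    by rewrite ler_wpM2l// lerD.
  rewrite /m; move: (C * _) (C * _) => u v; lra.
have summ : \sum_j m j = \sum_j Phi (x j) (y j) - N * (eta / 2) -
    C * (\sum_j @grid_step n X j + \sum_j @grid_step n Y j +
         N * (grid_shift n X + grid_shift n Y)).
  exact: sum_error.
have sX := grid_step_sum n cX; have sY := grid_step_sum n cY.
have bound : C * (N^-1 * \sum_j @grid_step n X j + N^-1 * \sum_j @grid_step n Y j +
     (grid_shift n X + grid_shift n Y)) <= C * (8 * pi) / N.
  rewrite -mulrA ler_wpM2l//.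
  have -> : 8 * pi / N = 2 * pi / N + 2 * pi / N + (2 * pi / N + 2 * pi / N) by field; rewrite gt_eqF.
  by rewrite !lerD.
have E : N^-1 * \sum_j m j = N^-1 * \sum_j Phi (x j) (y j) - eta / 2 -
   C * (N^-1 * \sum_j @grid_step n X j + N^-1 * \sum_j @grid_step n Y j +
     (grid_shift n X + grid_shift n Y)).
  by rewrite summ; field; rewrite gt_eqF.
have P0 : 0 <= N^-1 * \sum_j Phi (x j) (y j) by rewrite mulr_ge0// invr_ge0 ltW.
move: E step bound nC P0; rewrite -/N.
move: (C * (8 * pi) / N) => A4; move: (C * _) => A3.
move: (N^-1 * \sum_j m j) => A1; move: (N^-1 * _) => A2; lra.
Qed.

End RiemannSums.

(** * Displacement convexity of the logarithmic energy *)

Section SliceEnergy.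
Context {R : realType}.
Local Open Scope ereal_scope.

Lemma measurable_arc_energy : measurable_fun setT (@arc_energy R).
Proof.
apply: measurableT_comp => //.
apply: (measurableT_comp (@measurable_lne_EFin R)).
apply: measurableT_comp => //.
apply: continuous_measurable_fun => u.
apply: (@continuous_comp _ _ _ (fun u : R => u / 2)%R sin); last exact: continuous_sin.
by apply: cvgM; [exact: cvg_id|exact: cvg_cst].
Qed.

Variables (X : R -> R).
Hypothesis mX : measurable_fun setT X.

Lemma measurable_pair_energy :
  measurable_fun setT (fun p : measurableTypeR R * measurableTypeR R =>
    arc_energy (X p.1 - X p.2)%R).
Proof.
apply: (measurableT_comp measurable_arc_energy).
apply: measurable_funB; first exact: (measurableT_comp mX).
exact: (measurableT_comp mX).
Qed.

Lemma measurable_inner_energy :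
  measurable_fun setT (fun s : R => \int[unif]_t arc_energy (X s - X t)%R).
Proof.
have := @measurable_fun_fubini_tonelli_F _ _ (measurableTypeR R) (measurableTypeR R) R unif
  _ measurable_pair_energy; apply => p; exact: arc_energy_ge0.
Qed.

Lemma measurable_slice_energy (s : R) :
  measurable_fun setT (fun t : R => arc_energy (X s - X t)%R).
Proof.
apply: (measurableT_comp measurable_arc_energy).
exact: measurable_funB.
Qed.

Lemma inner_energy_ge0 s : 0 <= \int[unif]_t arc_energy (X s - X t)%R.
Proof. by apply: integral_ge0 => t _; exact: arc_energy_ge0. Qed.

Lemma lift_energy_ge0 : 0 <= lift_energy X.
Proof. by apply: integral_ge0 => s _; exact: inner_energy_ge0. Qed.

End SliceEnergy.

Section DisplacementConvexity.
Context {R : realType}.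
Variables (X Y : R -> R) (theta : R).
Hypotheses (cX : centered_lift X) (cY : centered_lift Y) (th : 0 < theta < 1).
Local Open Scope ereal_scope.

Let Z t : R := ((1 - theta) * X t + theta * Y t)%R.
Let d t : R := (Y t - X t)%R.
Let k : R := (theta * (1 - theta) / 8)%R.

(** For t <= s the increments of X and Y from t to s both lie in [0, 2 * pi],
the interval on which the kernel is convex: this is why the two measures are
matched monotonically. *)
Lemma arc_energy_lift_convex (s t : R) :
  arc_energy (Z s - Z t)%R + (k * (d s - d t) ^+ 2)%:E <=
  (1 - theta)%:E * arc_energy (X s - X t)%R + theta%:E * arc_energy (Y s - Y t)%R.
Proof.
wlog ts : s t / (t <= s)%R => [H|].
  have [|/ltW st] := leP t s; first exact: H.
  have := H t s st.
  have sym (a b : R) : arc_energy (a - b)%R = arc_energy (b - a)%R.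
    by rewrite -arc_energyN opprB.
  by rewrite (sym (Z t)) (sym (X t)) (sym (Y t)) -[((d t - d s) ^+ 2)%R]sqrrN opprB.
have [Xm Xw _] := cX; have [Ym Yw _] := cY.
have u2 : (0 <= X s - X t <= 2 * pi)%R.
  by rewrite subr_ge0 Xm//= lerBlDl Xw.
have v2 : (0 <= Y s - Y t <= 2 * pi)%R.
  by rewrite subr_ge0 Ym//= lerBlDl Yw.
have := arc_energy_convex th u2 v2.
have -> : ((1 - theta) * (X s - X t) + theta * (Y s - Y t) = Z s - Z t)%R by rewrite /Z; ring.
by have -> : ((X s - X t - (Y s - Y t)) ^+ 2 = (d s - d t) ^+ 2)%R by rewrite /d; ring.
Qed.

Lemma bounded_displacement : bounded_mfun d.
Proof. by apply: bounded_mfunB; exact: centered_lift_bounded. Qed.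

Lemma displacement_mean0 : umean d = 0%R.
Proof.
have [_ _ X0] := cX; have [_ _ Y0] := cY.
by rewrite umeanB ?X0 ?Y0 ?subrr//; exact: centered_lift_bounded.
Qed.

Let D := umean (fun t => d t ^+ 2)%R.

Let bd2 : bounded_mfun (fun t => d t ^+ 2)%R.
Proof. by apply: bounded_mfunM; exact: bounded_displacement. Qed.

(** Expanding the square, the cross term vanishes as the displacement has mean
zero. *)
Lemma inner_variance s : \int[unif]_t (k * (d s - d t) ^+ 2)%:E = (k * (d s ^+ 2 + D))%:E.
Proof.
have bd := bounded_displacement.
have b1 := bounded_mfunZ (- (2 * d s))%R bd.
have b2 := bounded_mfunD (bounded_mfun_cst (d s ^+ 2)%R) b1.
have b3 := bounded_mfunD b2 bd2.
have E : (fun t => k * (d s - d t) ^+ 2)%R =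
    (fun t => k * (d s ^+ 2 + - (2 * d s) * d t + d t ^+ 2))%R.
  by apply/funext => t; ring.
transitivity (umean (fun t => k * (d s - d t) ^+ 2)%R)%:E.
  by apply: umeanE; rewrite E; exact: bounded_mfunZ.
congr EFin; rewrite E umeanZ// umeanD// umeanD//; last exact: bounded_mfun_cst.
by rewrite umean_cst umeanZ// displacement_mean0 mulr0 addr0.
Qed.

(** Integrating the pointwise inequality twice. The gain
(d s - d t) ^+ 2 has double mean twice that of d ^+ 2, which turns the
coefficient 1 / 8 into 1 / 4. *)
Lemma lift_energy_convex :
  lift_energy Z + (theta * (1 - theta) / 4 * D)%:E <=
  (1 - theta)%:E * lift_energy X + theta%:E * lift_energy Y.
Proof.
have /andP[th0 th1] := th.
have t0 : (0 <= theta)%R := ltW th0.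
have t1 : (0 <= 1 - theta)%R by rewrite subr_ge0 ltW.
have k0 : (0 <= k)%R by rewrite /k !mulr_ge0.
have [mX _] := centered_lift_bounded cX.
have [mY _] := centered_lift_bounded cY.
have [md _] := bounded_displacement.
have mZ : measurable_fun setT Z by apply: measurable_funD; exact: measurable_funM.
have D0 : (0 <= D)%R by apply: Rintegral_ge0 => t _; exact: sqr_ge0.
have -> : (theta * (1 - theta) / 4 * D)%:E =
    \int[unif]_s \int[unif]_t (k * (d s - d t) ^+ 2)%:E.
  under eq_integral do rewrite inner_variance.
  have bc := bounded_mfunD bd2 (bounded_mfun_cst D).
  rewrite (umeanE (bounded_mfunZ k bc)) umeanZ// umeanD//; last exact: bounded_mfun_cst.
  by rewrite umean_cst -/D /k; congr EFin; field.
have mk s : measurable_fun setT (fun t => (k * (d s - d t) ^+ 2)%:E).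
  apply/measurable_EFinP; apply: measurable_funM => //.
  by apply: measurable_funX; exact: measurable_funB.
have mk2 : measurable_fun setT (fun s => \int[unif]_t (k * (d s - d t) ^+ 2)%:E).
  rewrite (_ : (fun s => _) = fun s => (k * (d s ^+ 2 + D))%:E); last first.
    by apply/funext => s; exact: inner_variance.
  apply/measurable_EFinP; apply: measurable_funM => //.
  by apply: measurable_funD => //; exact: measurable_funX.
have kk s t : 0 <= (k * (d s - d t) ^+ 2)%:E by rewrite lee_fin mulr_ge0// sqr_ge0.
have ae := @arc_energy_ge0 R.
rewrite -ge0_integralD//; last 3 first.
- by move=> s _; exact: inner_energy_ge0.
- exact: measurable_inner_energy.
- by move=> s _; apply: integral_ge0.
rewrite -[X in _ <= X + _]ge0_integralZl//; last 2 first.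
- exact: measurable_inner_energy.
- by move=> s _; exact: inner_energy_ge0.
rewrite -[X in _ <= _ + X]ge0_integralZl//; last 2 first.
- exact: measurable_inner_energy.
- by move=> s _; exact: inner_energy_ge0.
have mcX := measurable_inner_energy mX; have mcY := measurable_inner_energy mY.
rewrite -ge0_integralD//; last 4 first.
- by move=> s _; apply: mule_ge0; [rewrite lee_fin|exact: inner_energy_ge0].
- exact: measurable_funeM.
- by move=> s _; apply: mule_ge0; [rewrite lee_fin|exact: inner_energy_ge0].
- exact: measurable_funeM.
have mR1 : measurable_fun setT (fun s =>
    (1 - theta)%:E * (\int[unif]_t arc_energy (X s - X t)%R) +
    theta%:E * (\int[unif]_t arc_energy (Y s - Y t)%R)).
  by apply: emeasurable_funD; exact: measurable_funeM.
have mL1 : measurable_fun setT (fun s => \int[unif]_t arc_energy (Z s - Z t)%R +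
    \int[unif]_t (k * (d s - d t) ^+ 2)%:E).
  by apply: emeasurable_funD; [exact: (measurable_inner_energy mZ)|exact: mk2].
apply: ge0_le_integral => //.
  by move=> s _; apply: adde_ge0; [exact: inner_energy_ge0|exact: integral_ge0].
move=> s _.
have sX := measurable_slice_energy mX s; have sY := measurable_slice_energy mY s.
have sZ := measurable_slice_energy mZ s.
have mR2 : measurable_fun setT (fun t =>
    (1 - theta)%:E * arc_energy (X s - X t)%R + theta%:E * arc_energy (Y s - Y t)%R).
  by apply: emeasurable_funD; exact: measurable_funeM.
have mL2 : measurable_fun setT (fun t =>
    arc_energy (Z s - Z t)%R + (k * (d s - d t) ^+ 2)%:E).
  by apply: emeasurable_funD.
rewrite -ge0_integralD//; last exact: mk.
rewrite -[X in _ <= X + _]ge0_integralZl// -[X in _ <= _ + X]ge0_integralZl//.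
rewrite -ge0_integralD//; last 4 first.
- by move=> t _; apply: mule_ge0.
- exact: measurable_funeM.
- by move=> t _; apply: mule_ge0.
- exact: measurable_funeM.
apply: ge0_le_integral => //.
  by move=> t _; apply: adde_ge0.
by move=> t _; exact: arc_energy_lift_convex.
Qed.

End DisplacementConvexity.

(** * Uniform continuity in additive form *)

Section AlmostLipschitz.
Context {R : realType}.

(** For each pair (a, a') the inequality holds near the pair for all large C:
by continuity if a = a', and since |a - a'| stays away from 0 otherwise.
Compactness makes C uniform. *)
Lemma continuous_almost_lipschitz1 (u : R -> R) (M eps : R) : continuous u -> 0 < eps ->
  exists2 C, 0 <= C & forall a a', `|a| <= M -> `|a'| <= M ->
    `|u a - u a'| <= eps + C * `|a - a'|.
Proof.
move=> cu e0.
pose K : set (R * R) := `[- M, M]%classic `*` `[- M, M]%classic.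
have cK : compact K by apply: compact_setX; exact: segment_compact.
pose P (C : R) (p : R * R) := `|u p.1 - u p.2| <= eps + C * `|p.1 - p.2|.
have cont : forall p : R * R, `|u q.1 - u q.2| @[q --> p] --> `|u p.1 - u p.2|.
  move=> p; apply: cvg_norm; apply: cvgB.
    by apply: (@continuous_comp _ _ _ (fun q : R * R => q.1) u); [exact: cvg_fst|exact: cu].
  by apply: (@continuous_comp _ _ _ (fun q : R * R => q.2) u); [exact: cvg_snd|exact: cu].
have contd : forall p : R * R, `|q.1 - q.2| @[q --> p] --> `|p.1 - p.2|.
  by move=> p; apply: cvg_norm; apply: cvgB; [exact: cvg_fst|exact: cvg_snd].
have cov : \forall C \near +oo, K `<=` P C.
  move/compact_near_coveringP : cK; apply => p Kp.
  have [pp|np] := eqVneq p.1 p.2.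
    have near1 : \forall q \near p, `|u q.1 - u q.2| < eps.
      have := cont p => /(cvgr_lt _); apply; by rewrite pp subrr normr0.
    near=> q C => /=; rewrite /P; apply: le_trans (_ : eps <= _).
      by apply: ltW; near: q.
    by rewrite lerDl mulr_ge0//; near: C; exact: nbhs_pinfty_ge.
  pose d := `|p.1 - p.2|; have d0 : 0 < d by rewrite normr_gt0 subr_eq0.
  pose w := `|u p.1 - u p.2| + 1.
  have near1 : \forall q \near p, `|u q.1 - u q.2| < w.
    by have := cont p => /(cvgr_lt _); apply; rewrite /w ltrDl.
  have near2 : \forall q \near p, d / 2 < `|q.1 - q.2|.
    by have := contd p => /(cvgr_gt _); apply; rewrite ltr_pdivrMr// ltr_pMr// ltr1n.
  near=> q C => /=; rewrite /P.
  have h1 : `|u q.1 - u q.2| < w by near: q.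
  have h2 : d / 2 < `|q.1 - q.2| by near: q.
  have h3 : w / (d / 2) <= C by near: C; apply: nbhs_pinfty_ge; rewrite num_real.
  have w0 : 0 <= w by rewrite /w addr_ge0.
  have : w <= C * `|q.1 - q.2|.
    move: h3; rewrite ler_pdivrMr ?divr_gt0// => /le_trans; apply.
    have C0 : 0 <= C by near: C; exact: nbhs_pinfty_ge.
    by rewrite ler_wpM2l// ltW.
  lra.
near (pinfty_nbhs R) => C.
exists C; first by near: C; exact: nbhs_pinfty_ge.
move=> a a' aM a'M; have : K `<=` P C by near: C.
by move=> /(_ (a, a')); apply; split; rewrite /= in_itv/= -ler_norml.
Unshelve. all: by end_near. Qed.

Lemma almost_lipschitz_affine (u : R -> R) (al be : R) : continuous u ->
  almost_lipschitz (fun a b => u (al * a + be * b)).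
Proof.
move=> cu M eps e0; pose k := `|al| + `|be|.
have k0 : 0 <= k by rewrite addr_ge0.
have [C C0 uC] := continuous_almost_lipschitz1 (k * M) cu e0.
have lin (a b L1 L2 : R) : `|a| <= L1 -> `|b| <= L2 ->
    `|al * a + be * b| <= `|al| * L1 + `|be| * L2.
  by move=> aL bL; rewrite (le_trans (ler_normD _ _))// !normrM lerD// ler_wpM2l.
exists (C * k) => [|a a' b b' aM a'M bM b'M]; first by rewrite mulr_ge0.
have h1 := lin _ _ _ _ aM bM; have h2 := lin _ _ _ _ a'M b'M.
rewrite -mulrDl in h1; rewrite -mulrDl in h2.
apply: le_trans (uC _ _ h1 h2) _; rewrite lerD2l -mulrA ler_wpM2l//.
have -> : al * a + be * b - (al * a' + be * b') = al * (a - a') + be * (b - b') by ring.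
apply: le_trans (lin _ _ _ _ (lexx _) (lexx _)) _.
by rewrite /k mulrDl lerD// ler_wpM2l// ?lerDl ?lerDr.
Qed.

Lemma almost_lipschitzD (F G : R -> R -> R) :
  almost_lipschitz F -> almost_lipschitz G ->
  almost_lipschitz (fun a b => F a b + G a b).
Proof.
move=> lF lG M eps e0; have e2 : 0 < eps / 2 by rewrite divr_gt0.
have [C C0 FC] := lF M _ e2; have [C' C'0 GC] := lG M _ e2.
exists (C + C') => [|a a' b b' aM a'M bM b'M]; first by rewrite addr_ge0.
have := FC _ _ _ _ aM a'M bM b'M; have := GC _ _ _ _ aM a'M bM b'M.
have -> : F a b + G a b - (F a' b' + G a' b') = (F a b - F a' b') + (G a b - G a' b') by ring.
move=> h1 h2; apply: le_trans (ler_normD _ _) _; rewrite mulrDl; lra.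
Qed.

Lemma almost_lipschitzZ (c : R) (F : R -> R -> R) : almost_lipschitz F ->
  almost_lipschitz (fun a b => c * F a b).
Proof.
move=> lF M eps e0; have c1 : 0 < `|c| + 1 by rewrite ltr_wpDl.
have [|C C0 FC] := lF M (eps / (`|c| + 1)); first by rewrite divr_gt0.
exists (`|c| * C) => [|a a' b b' aM a'M bM b'M]; first by rewrite mulr_ge0.
have := FC _ _ _ _ aM a'M bM b'M.
rewrite -mulrBr normrM => /(ler_wpM2l (normr_ge0 c)) /le_trans; apply.
have h : `|c| * (eps / (`|c| + 1)) <= eps.
  by rewrite mulrCA ger_pMr// ler_pdivrMr// mul1r lerDl.
by rewrite mulrDr -[in leRHS]mulrA lerD2r.
Qed.

End AlmostLipschitz.

Section CircleFunctions.
Context {R : realType}.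
Variables (f : circle R -> R).
Hypothesis cf : continuous f.

Lemma continuous_fun_circ : continuous (fun t : R => f (circ t)).
Proof.
by move=> t; apply: (@continuous_comp _ _ _ (circ : R -> circle R) f);
  [exact: continuous_circ|exact: cf].
Qed.

Lemma bounded_mfun_circ (X : R -> R) : measurable_fun setT X ->
  bounded_mfun (fun t => f (circ (X t))).
Proof.
move=> mX; split.
  exact: (measurableT_comp (continuous_measurable_fun continuous_fun_circ) mX).
have [C C0 uC] := continuous_almost_lipschitz1 (2 * pi) continuous_fun_circ ltr01.
exists (`|f (circ 0)| + (1 + C * (2 * pi))) => t.
rewrite -(circ_angle (circ (X t))); set a := angle _.
have /andP[a0 a1] : 0 <= a <= 2 * pi by exact: angle_itv.
have na : `|a| <= 2 * pi by rewrite ger0_norm.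
have n0 : `|0 : R| <= 2 * pi by rewrite normr0 mulr_ge0 ?pi_ge0.
have := uC _ _ na n0; rewrite subr0 => h.
have -> : f (circ a) = f (circ 0) + (f (circ a) - f (circ 0)) by ring.
apply: le_trans (ler_normD _ _) _; rewrite lerD2l.
by apply: le_trans h _; rewrite lerD2l ler_wpM2l.
Qed.

Lemma integral_law (X : R -> R) (mu : circle_prob R) :
  measurable_fun setT X -> law_of X mu ->
  (\int[mu]_z (f z)%:E = (umean (fun t => f (circ (X t))))%:E)%E.
Proof.
move=> mX XE.
have mcX : measurable_fun setT (circ \o X : measurableTypeR R -> borel_circle R).
  exact: (measurableT_comp (@measurable_circ R) mX).
have b := bounded_mfun_circ mX.
transitivity (\int[pushforward (@unif R) (circ \o X : measurableTypeR R -> borel_circle R)]_z (f z)%:E)%E.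
  by apply: eq_measure_integral => A mA _; exact: XE.
rewrite (integral_pushforward mcX)//.
- by rewrite preimage_setT umeanE.
- by apply/measurable_EFinP; exact: continuous_circle_measurable.
- by rewrite preimage_setT; exact: bounded_mfun_integrable.
Qed.

End CircleFunctions.

(** * Free pressure *)

Section ErealSup.
Context {R : realType}.
Local Open Scope ereal_scope.

(** Suprema of extended reals are handled one at a time, after discarding the
cases where one of the terms is -oo. *)
Lemma ereal_sup_convex_le (A B : set \bar R) (theta : R) (J : \bar R) :
  (0 < theta < 1)%R ->
  (forall a b, A a -> B b -> (1 - theta)%:E * a + theta%:E * b <= J) ->
  (1 - theta)%:E * ereal_sup A + theta%:E * ereal_sup B <= J.
Proof.
move=> /andP[t0 t1] AB; have t1' : (0 < 1 - theta)%R by rewrite subr_gt0.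
have [->|JNy] := eqVneq J +oo; first by rewrite leey.
(* One supremum at a time: c * sup A + y <= J as soon as c * a + y <= J on A *)
have sup1 (c : R) (S : set \bar R) (y : \bar R) : (0 < c)%R ->
    (forall a, S a -> c%:E * a + y <= J) -> c%:E * ereal_sup S + y <= J.
  move=> c0 SJ.
  have [->|yNy] := eqVneq y -oo; first by rewrite addeNy leNye.
  have [sS|] := eqVneq (ereal_sup S) -oo.
    by rewrite sS gt0_muleNy ?lte_fin// addNye leNye.
  rewrite -ltNye => /ereal_sup_gt[a0 Sa0 a0Ny].
  case: y yNy SJ => [y| |]// _ SJ; last first.
    have := SJ _ Sa0; case: a0 a0Ny {Sa0} => [r| |]// _.
    - by rewrite addey// leye_eq (negbTE JNy).
    - by rewrite gt0_muley ?lte_fin// addye// leye_eq (negbTE JNy).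
  case: (J) JNy SJ => [j| |]// _ SJ; last first.
    have := SJ _ Sa0; case: a0 a0Ny {Sa0} => [r| |]// _.
    by rewrite gt0_muley ?lte_fin.
  rewrite -leeBrDr// -EFinB muleC -lee_pdivlMr//.
  apply: ge_ereal_sup => a Sa.
  rewrite lee_pdivlMr// muleC EFinB leeBrDr//; exact: SJ.
rewrite addeC; apply: (sup1) => // b Bb; rewrite addeC; apply: (sup1) => // a Aa.
exact: AB.
Qed.

End ErealSup.

Section Assembly.
Context {R : realType}.
Variables (Q f g h : circle R -> R) (theta : R).
Hypotheses (cQ : continuous Q) (cf : continuous f) (cg : continuous g) (ch : continuous h).
Hypothesis th : 0 < theta < 1.

(** The integrand whose sum over the eigenvalues is the difference of the two
sides of the assumed inequality, when the matrices are diagonal with angles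
a, b and (1 - theta) * a + theta * b. *)
Definition transport_defect (a b : R) : R :=
  (h (circ ((1 - theta) * a + theta * b)) - Q (circ ((1 - theta) * a + theta * b)))
  - (1 - theta) * (f (circ a) - Q (circ a)) - theta * (g (circ b) - Q (circ b))
  + theta * (1 - theta) / 4 * (b - a) ^+ 2.

Lemma almost_lipschitz_transport_defect : almost_lipschitz transport_defect.
Proof.
have aff (u : circle R -> R) al be : continuous u ->
    almost_lipschitz (fun a b => u (circ (al * a + be * b))).
  by move=> cu; exact: (almost_lipschitz_affine _ _ (continuous_fun_circ cu)).
have fst (u : circle R -> R) : continuous u -> almost_lipschitz (fun a _ => u (circ a)).
  move=> cu; have := aff u 1 0 cu; congr almost_lipschitz.
  by apply/funext => a; apply/funext => b; rewrite mul1r mul0r addr0.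
have snd (u : circle R -> R) : continuous u -> almost_lipschitz (fun _ b => u (circ b)).
  move=> cu; have := aff u 0 1 cu; congr almost_lipschitz.
  by apply/funext => a; apply/funext => b; rewrite mul1r mul0r add0r.
have sq : almost_lipschitz (fun a b : R => ((-1) * a + 1 * b) ^+ 2).
  exact: (almost_lipschitz_affine _ _ (@exprn_continuous R 2)).
have := almost_lipschitzD (almost_lipschitzD (almost_lipschitzD
  (almost_lipschitzD (aff h (1 - theta) theta ch) (almost_lipschitzZ (-1) (aff Q (1 - theta) theta cQ)))
  (almost_lipschitzD (almost_lipschitzZ (- (1 - theta)) (fst f cf)) (almost_lipschitzZ (1 - theta) (fst Q cQ))))
  (almost_lipschitzD (almost_lipschitzZ (- theta) (snd g cg)) (almost_lipschitzZ theta (snd Q cQ))))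
  (almost_lipschitzZ (theta * (1 - theta) / 4) sq).
congr almost_lipschitz; apply/funext => a; apply/funext => b.
by rewrite /transport_defect; ring.
Qed.

Hypothesis hyp : forall (N : nat) (U V W : 'M[R[i]]_N), (0 < N)%N ->
    SU N U -> SU N V -> Zset theta U V W ->
    trace_fun h W >=
      (1 - theta) * trace_fun f U + theta * trace_fun g V
      + Rdefect Q theta W U V
      - theta * (1 - theta) / 4%:R * geodesic_dist U V ^+ 2.

Lemma transport_defect_sum_ge0 n (x y : 'I_n.+1 -> R) :
  \sum_j x j = 0 -> \sum_j y j = 0 ->
  (forall i j, (y i - x i) - (y j - x j) <= 2 * pi) ->
  0 <= \sum_j transport_defect (x j) (y j).
Proof.
move=> x0 y0 window; have /andP[th0 th1] := th.
have th01 : 0 <= theta <= 1 by rewrite !ltW.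
have := hyp (ltn0Sn n) (SU_diag_cis x0) (SU_diag_cis y0) (diag_geodesic_Zset th01 x0 y0 window).
rewrite geodesic_dist_diag_cis// sqr_sqrtr; last by apply: sumr_ge0 => j _; exact: sqr_ge0.
rewrite /Rdefect /diag_geodesic !trace_fun_diag_cis -subr_ge0.
congr (0 <= _).
rewrite !mulr_sumr !(=^~ sumrN, =^~ big_split) /=.
rewrite /transport_defect; apply: eq_bigr => j _.
have -> : x j + theta * (y j - x j) = (1 - theta) * x j + theta * y j by ring.
by ring.
Qed.

(** The limit of the matrix inequality as the size tends to infinity. *)
Lemma transport_defect_mean_ge0 (X Y : R -> R) : centered_lift X -> centered_lift Y ->
  (1 - theta) * (umean (fun t => f (circ (X t))) - umean (fun t => Q (circ (X t))))
  + theta * (umean (fun t => g (circ (Y t))) - umean (fun t => Q (circ (Y t)))) <=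
  umean (fun t => h (circ ((1 - theta) * X t + theta * Y t))) - umean (fun t => Q (circ ((1 - theta) * X t + theta * Y t)))
  + theta * (1 - theta) / 4 * umean (fun t => (Y t - X t) ^+ 2).
Proof.
move=> cX cY; pose Z t : R := (1 - theta) * X t + theta * Y t.
have bX := centered_lift_bounded cX; have bY := centered_lift_bounded cY.
have [mX _] := bX; have [mY _] := bY.
have [mZ _] : bounded_mfun Z by apply: bounded_mfunD; exact: bounded_mfunZ.
have bhZ := bounded_mfun_circ ch mZ; have bQZ := bounded_mfun_circ cQ mZ.
have bfX := bounded_mfun_circ cf mX; have bQX := bounded_mfun_circ cQ mX.
have bgY := bounded_mfun_circ cg mY; have bQY := bounded_mfun_circ cQ mY.
have bd := bounded_mfunB bY bX; have bd2 := bounded_mfunM bd bd.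
have b1 := bounded_mfunB bhZ bQZ.
have b2 := bounded_mfunZ (1 - theta) (bounded_mfunB bfX bQX).
have b3 := bounded_mfunZ theta (bounded_mfunB bgY bQY).
have b4 := bounded_mfunZ (theta * (1 - theta) / 4) bd2.
have b12 := bounded_mfunB b1 b2; have b123 := bounded_mfunB b12 b3.
have b1234 := bounded_mfunD b123 b4.
have := riemann_nonneg cX cY almost_lipschitz_transport_defect b1234 transport_defect_sum_ge0.
have -> : umean (fun t => transport_defect (X t) (Y t)) =
    umean (fun t => h (circ (Z t)) - Q (circ (Z t)) -
      (1 - theta) * (f (circ (X t)) - Q (circ (X t))) -
      theta * (g (circ (Y t)) - Q (circ (Y t))) +
      theta * (1 - theta) / 4 * ((Y t - X t) * (Y t - X t))) by [].
rewrite (umeanD b123 b4) (umeanB b12 b3) (umeanB b1 b2) (umeanB bhZ bQZ).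
rewrite (umeanZ (1 - theta) (bounded_mfunB bfX bQX)) (umeanZ theta (bounded_mfunB bgY bQY)).
rewrite (umeanZ (theta * (1 - theta) / 4) bd2) (umeanB bfX bQX) (umeanB bgY bQY).
have -> : umean (fun t => (Y t - X t) ^+ 2) = umean (fun t => (Y t - X t) * (Y t - X t)) by [].
lra.
Qed.

Local Open Scope ereal_scope.

Lemma circle_centered_lift (mu : circle_prob R) :
  exists2 X, centered_lift X & law_of X mu.
Proof.
have [X [Xm Xw X0 XE]] := circle_lift mu.
exists X => //; split => //.
by rewrite /umean /Rintegral X0.
Qed.

Lemma law_exists (Z : R -> R) : measurable_fun setT Z ->
  exists mu : circle_prob R, law_of Z mu.
Proof.
move=> mZ; pose cZ : {mfun measurableTypeR R >-> borel_circle R} :=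
  HB.pack (circ \o Z : measurableTypeR R -> borel_circle R)
    (@isMeasurableFun.Build _ _ (measurableTypeR R) (borel_circle R) (circ \o Z)
      (measurableT_comp (@measurable_circ R) mZ)).
by exists (distribution unif cZ) => A mA.
Qed.

Lemma lifted_free_pressure (u : circle R -> R) (X : R -> R) (mu : circle_prob R) :
  continuous u -> centered_lift X -> law_of X mu ->
  \int[mu]_z (u z)%:E - relative_free_entropy Q mu =
  (umean (fun t => u (circ (X t))))%:E -
  (lift_energy X + (umean (fun t => Q (circ (X t))) - ln 2)%:E + energy_constant Q).
Proof.
move=> cu cX XE; have [mX _] := centered_lift_bounded cX.
rewrite /relative_free_entropy !(integral_law _ mX XE)// (free_entropy_law mX XE).
congr (_ - (_ + _)).
have := lift_energy_ge0 X; case: (lift_energy X) => [e| |]// _.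
by rewrite -EFinB -EFinN -!EFinD; congr EFin; ring.
Qed.

(** The displacement interpolation of mu and nu competes in the supremum on
the right. The quadratic loss in the limit of the matrix inequality is the gain
in the convexity of the energy. If the constant of Q is infinite, or if mu or
nu has infinite energy, the left-hand side is -oo or the right-hand side +oo. *)
Lemma free_pressure_convex_pair (mu nu : circle_prob R) :
  (1 - theta)%:E * (\int[mu]_z (f z)%:E - relative_free_entropy Q mu) +
  theta%:E * (\int[nu]_z (g z)%:E - relative_free_entropy Q nu) <=
  relative_free_pressure Q h.
Proof.
have /andP[th0 th1] := th; have th1' : (0 < 1 - theta)%R by rewrite subr_gt0.
have [X cX XE] := circle_centered_lift mu; have [Y cY YE] := circle_centered_lift nu.
pose Z t : R := ((1 - theta) * X t + theta * Y t)%R.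
have [Xm Xw X0] := cX; have [Ym Yw Y0] := cY.
have bX := centered_lift_bounded cX; have bY := centered_lift_bounded cY.
have cZ : centered_lift Z.
  split.
  - by move=> s t st; rewrite lerD// ler_wpM2l ?(ltW th0) ?(ltW th1')// ?Xm ?Ym.
  - move=> s t; have := Xw s t; have := Yw s t; rewrite /Z; nra.
  - rewrite umeanD; [|exact: bounded_mfunZ|exact: bounded_mfunZ].
    by rewrite !umeanZ// X0 Y0 !mulr0 addr0.
have [mZ _] := centered_lift_bounded cZ.
have [la laE] := law_exists mZ.
apply: (@le_trans _ _ (\int[la]_z (h z)%:E - relative_free_entropy Q la)); last first.
  by apply: ereal_sup_ubound; exists la.
rewrite (lifted_free_pressure cf cX XE) (lifted_free_pressure cg cY YE).
rewrite (lifted_free_pressure ch cZ laE).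
have conv := lift_energy_convex cX cY th.
have Phi := transport_defect_mean_ge0 cX cY.
move: conv Phi; rewrite -/Z /=.
move: (lift_energy_ge0 X) (lift_energy_ge0 Y) (lift_energy_ge0 Z).
move: (umean (fun t => (Y t - X t) ^+ 2))%R => D.
move: (umean _) (umean _) (umean _) (umean _) (umean _) (umean _) => hZ QZ fX QX gY QY.
case: (energy_constant Q) => [b| |].
- case: (lift_energy X) => [eX| |]// _; last first.
    by move=> _ _ _ _; rewrite /= gt0_muleNy ?lte_fin// addNye leNye.
  case: (lift_energy Y) => [eY| |]// _; last first.
    by move=> _ _ _; rewrite /= gt0_muleNy ?lte_fin// addeNy leNye.
  case: (lift_energy Z) => [eZ| |]// _.
  rewrite /= !lee_fin; lra.
- by case: (lift_energy X) => [eX| |]// _ _ _ _ _; rewrite /= gt0_muleNy ?lte_fin// addNye leNye.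
- by move=> _ _ _ _ _; rewrite !addeNy /= leey.
Qed.

Lemma free_pressure_convex :
  (1 - theta)%:E * relative_free_pressure Q f + theta%:E * relative_free_pressure Q g <=
  relative_free_pressure Q h.
Proof.
apply: ereal_sup_convex_le => // _ _ [mu _ <-] [nu _ <-].
exact: free_pressure_convex_pair.
Qed.

End Assembly.

Unset Implicit Arguments.

Theorem lemma2p2 (R : realType) (Q f g h : circle R -> R) (theta : R)
  (cQ : continuous Q) (cf : continuous f) (cg : continuous g)
  (ch : continuous h) (theta_gt0 : 0 < theta) (theta_lt1 : theta < 1)
  (hyp : forall (N : nat) (U V W : 'M[R[i]]_N), (0 < N)%N ->
    SU N U -> SU N V -> Zset theta U V W ->
    trace_fun h W >=
      (1 - theta) * trace_fun f U + theta * trace_fun g V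
      + Rdefect Q theta W U V
      - theta * (1 - theta) / 4%:R * geodesic_dist U V ^+ 2) :
  (relative_free_pressure Q h >=
     (1 - theta)%:E * relative_free_pressure Q f
     + theta%:E * relative_free_pressure Q g)%E.
Proof.
have th : 0 < theta < 1 by rewrite theta_gt0 theta_lt1.
exact: free_pressure_convex cQ cf cg ch th hyp.
Qed.
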